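(* Let $d,n\geq1$ and let $C\in\mathbb{R}^{dn\times dn}$ be real symmetric positive semidefinite with $d\times d$ blocks $C_{ij}$. Let $X_1,\dots,X_n\in\mathbb{R}^{d\times nd}$ be any matrices with $X_iX_i^T=I_{d\times d}$ for all $i$. Let $R\in\mathbb{R}^{nd\times d}$ have i.i.d. real $\mathcal{N}(0,\frac1d)$ entries and let $V_i=\mathcal{P}(X_iR)\in\mathcal{O}_d$. Then \[ \mathbb{E} \left[ \sum_{i=1}^n\sum_{j=1}^n\operatorname{tr}\left(C_{ij}^TV_iV_j^T\right) \right] \geq \alpha_{\mathbb{R}}(d)^2 \sum_{i=1}^n\sum_{j=1}^n\operatorname{tr}\left(C_{ij}^TX_iX_j^T\right). \] Analogously, let $C\in\mathbb{C}^{dn\times dn}$ be Hermitian positive semidefinite, let $Y_1,\dots,Y_n\in\mathbb{C}^{d\times nd}$ satisfy $Y_iY_i^H=I_{d\times d}$, let $R\in\mathbb{C}^{nd\times d}$ have i.i.d. complex $\mathcal{N}(0,\frac1d)$ entries and let $W_i=\mathcal{P}(Y_iR)\in\mathcal{U}_d$. Then \[ \mathbb{E} \left[ \sum_{i=1}^n\sum_{j=1}^n\operatorname{tr}\left(C_{ij}^HW_iW_j^H\right) \right] \geq \alpha_{\mathbb{C}}(d)^2 \sum_{i=1}^n\sum_{j=1}^n\operatorname{tr}\left(C_{ij}^HY_iY_j^H\right). \]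
   Context: $\mathcal{O}_d$ is the group of real $d\times d$ orthogonal matrices and $\mathcal{U}_d$ the group of complex $d\times d$ unitary matrices. For a real $d\times d$ matrix $X$, $\mathcal{P}(X)=\operatorname{argmin}_{Z\in\mathcal{O}_d}\|Z-X\|_F$; for a complex $d\times d$ matrix $Y$, $\mathcal{P}(Y)=\operatorname{argmin}_{Z\in\mathcal{U}_d}\|Z-Y\|_F$. A complex Gaussian $\mathcal{N}(0,\frac1d)$ entry is circularly symmetric with $\mathbb{E}|z|^2=\frac1d$. With $G_{\mathbb{R}}$ (resp. $G_{\mathbb{C}}$) a $d\times d$ matrix of i.i.d. real (resp. complex) $\mathcal{N}(0,d^{-1})$ entries, $\alpha_{\mathbb{K}}(d)=\mathbb{E}\left[\frac1d\sum_{j=1}^d\sigma_j(G_{\mathbb{K}})\right]$ for $\mathbb{K}\in\{\mathbb{R},\mathbb{C}\}$, where $\sigma_j$ is the $j$-th singular value. *)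

(* Defs.v *)
From HB Require Import structures.
From mathcomp Require Import all_boot all_order all_algebra.
From mathcomp Require Import complex.
From mathcomp Require Import all_classical all_reals all_analysis.
Set Implicit Arguments. Unset Strict Implicit. Unset Printing Implicit Defensive.
Import Order.TTheory GRing.Theory Num.Theory.
Local Open Scope ring_scope.

Section Defs.
Variable R : realType.

(** ---------- Gaussian expectation ----------
   [gauss_iter s N f] is the expectation of [f v], where v(0), ..., v(N-1)
   are i.i.d. real N(0, s^2) random variables (s = standard deviation),
   written as the iterated integral against the product of N copies of
   the normal law [normal_prob 0 s] (coordinates >= N are set to 0). *)
Fixpoint gauss_iter (s : R) (N : nat) (f : (nat -> R) -> R) : \bar R :=
  match N with
  | 0 => (f (fun _ => 0))%:E
  | N'.+1 => (\int[normal_prob 0 s]_x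
               gauss_iter s N' (fun v => f (fun k => if k == N' then x else v k)))%E
  end.

Definition mx_of_seqR (m k : nat) (v : nat -> R) : 'M[R]_(m, k) :=
  \matrix_(i < m, j < k) v (i * k + j)%N.

Definition mx_of_seqC (m k : nat) (v : nat -> R) : 'M[R[i]]_(m, k) :=
  \matrix_(i < m, j < k) Complex (v (2 * (i * k + j))%N) (v (2 * (i * k + j)).+1).

Definition EgaussR (d m k : nat) (f : 'M[R]_(m, k) -> R) : \bar R :=
  gauss_iter (Num.sqrt (d%:R^-1)) (m * k) (fun v => f (mx_of_seqR m k v)).

(** E[f(G)] for G an m x k matrix with i.i.d. circularly symmetric complex
    N(0, 1/d) entries: real and imaginary parts i.i.d. real N(0, 1/(2d)),
    so that E|z|^2 = 1/d. *)
Definition EgaussC (d m k : nat) (f : 'M[R[i]]_(m, k) -> R) : \bar R :=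
  gauss_iter (Num.sqrt ((2 * d)%:R^-1)) (2 * (m * k)) (fun v => f (mx_of_seqC m k v)).

Definition adjmx (m k : nat) (A : 'M[R[i]]_(m, k)) : 'M[R[i]]_(k, m) :=
  (map_mx (@conjc R) A)^T.

Definition frobR (m k : nat) (A : 'M[R]_(m, k)) : R :=
  Num.sqrt (\sum_(i < m) \sum_(j < k) (A i j) ^+ 2).

Definition frobC (m k : nat) (A : 'M[R[i]]_(m, k)) : R :=
  Num.sqrt (\sum_(i < m) \sum_(j < k)
              ((complex.Re (A i j)) ^+ 2 + (complex.Im (A i j)) ^+ 2)).

Definition orthogonal (d : nat) (Q : 'M[R]_d) : Prop := Q *m Q^T = 1%:M.
Definition unitary (d : nat) (Q : 'M[R[i]]_d) : Prop := Q *m adjmx Q = 1%:M.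

Definition projO (d : nat) (X : 'M[R]_d) : 'M[R]_d :=
  xget 0 [set Z | orthogonal Z /\
                  forall Z', orthogonal Z' -> frobR (Z - X) <= frobR (Z' - X)].

Definition projU (d : nat) (Y : 'M[R[i]]_d) : 'M[R[i]]_d :=
  xget 0 [set Z | unitary Z /\
                  forall Z', unitary Z' -> frobC (Z - Y) <= frobC (Z' - Y)].

Definition singvalsR (d : nat) (G : 'M[R]_d) : seq R :=
  xget [::] [set s : seq R | size s = d /\ all (fun x => 0 <= x) s /\
     char_poly (G^T *m G) = \prod_(x <- s) ('X - (x ^+ 2)%:P)].

Definition singvalsC (d : nat) (G : 'M[R[i]]_d) : seq R :=
  xget [::] [set s : seq R | size s = d /\ all (fun x => 0 <= x) s /\
     char_poly (adjmx G *m G) = \prod_(x <- s) ('X - ((x ^+ 2)%:C)%C%:P)].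

Definition alphaR (d : nat) : \bar R :=
  @EgaussR d d d (fun G : 'M[R]_d => d%:R^-1 * \sum_(x <- singvalsR G) x).
Definition alphaC (d : nat) : \bar R :=
  @EgaussC d d d (fun G : 'M[R[i]]_d => d%:R^-1 * \sum_(x <- singvalsC G) x).

(** the (i,j) d x d block of an (n d) x (n d) matrix;
    global row index of (block i, local row a) is i*d + a *)
Definition blk (T : Type) (n d : nat) (C : 'M[T]_(n * d)) (i j : 'I_n) : 'M[T]_d :=
  \matrix_(a < d, b < d) C (mxvec_index i a) (mxvec_index j b).

Definition psdR (N : nat) (C : 'M[R]_N) : Prop :=
  C^T = C /\ forall v : 'cV[R]_N, 0 <= (v^T *m C *m v) 0 0.
Definition psdC (N : nat) (C : 'M[R[i]]_N) : Prop :=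
  adjmx C = C /\ forall v : 'cV[R[i]]_N, 0 <= (adjmx v *m C *m v) 0 0.

End Defs.

(* Main.v *)
(* Write [W_i = P(X_i R)]. As [C] is positive semidefinite,
   [0 <= E sum tr(C_ij^* (W_i - a X_i R) (W_j - a X_j R)^* )] for every real [a].
   The law of [R] is invariant under unitary (orthogonal) matrices, acting from the left.
   The reflection in the row space of [X_i] shows that [X_j] may be replaced by its
   projection [X_j X_i^* X_i] in [E W_i R^* X_j^*], and the unitary matrices which preserve
   that space show that [E W_i R^* X_i^*] is scalar: hence [E W_i R^* X_j^* = a X_i X_j^*],
   where [a = alpha(d)]. Since also [E R R^* = 1], the inequality above becomes the theorem.
   The real case is treated inside complex matrices. As [P] is an arbitrary choice on
   singular matrices, the integrands need not be measurable there, and integrals are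
   compared up to null sets. *)
From HB Require Import structures.
From mathcomp Require Import all_boot all_order all_algebra perm.
From mathcomp Require Import complex.
From mathcomp Require Import all_classical all_reals all_analysis.
From mathcomp Require Import measurable_realfun.
From mathcomp Require Import ring lra.
Require Import Defs.
Set Implicit Arguments.
Unset Strict Implicit.
Unset Printing Implicit Defensive.
Import Order.TTheory GRing.Theory Num.Theory.
Import numFieldNormedType.Exports.
Local Open Scope classical_set_scope.
Local Open Scope ring_scope.

(** * Gaussian measures on the space of real sequences *)

(** Expanding the nonnegative quantity gives [E w - 2 a^2 T + a^2 E q], where [T] is the double sum
    on the right and [q] the quadratic term in the Gaussian. The coefficient [a] is the very
    multiplier of the cross terms, so an upper bound [E q <= T], that is, an upper bound on second
    moments, closes the argument. Two obstacles shape the development. The expectation is an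
    iterated integral over coordinates, so its invariance is built up from the plane: shears give
    plane rotations, these and sign changes give reflections, and reflections generate all
    orthogonal matrices. The integrand contains an argmin: its measurability comes from an iteration
    converging to the polar factor of an invertible matrix, and singular matrices are shown to be
    negligible. The matrix [E W_i R^H] is handled through the real functional that sends [B] to
    [E Re tr (B W_i R^H)]. A boolean [b] selects the real or the complex case; it constrains the
    unitary matrices allowed to act, which is why every invariance argument keeps track of
    [scalmx b]. *)

Section sequence_space.
Variable R : realType.

Definition cylinders : set (set (nat -> R)) :=
  [set A | exists (k : nat) (B : set R), measurable B /\ A = (fun v => v k) @^-1` B].

(** The product sigma-algebra on all sequences: [gauss_iter] integrates functions of a whole
    sequence, so they live directly on this space, whatever the number of coordinates. *)
Definition seqsp := g_sigma_algebraType cylinders.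

Lemma measurable_coord (k : nat) : measurable_fun setT (fun v : seqsp => v k).
Proof.
move=> _ B mB; rewrite setTI; apply: sub_sigma_algebra.
by exists k, B.
Qed.

Lemma measurable_seqspP d (T : measurableType d) (f : T -> seqsp) :
  (forall k, measurable_fun setT (fun t => f t k)) -> measurable_fun setT f.
Proof.
move=> mf; apply: (@measurability _ _ _ _ setT f cylinders) => //.
move=> _ [_ [k [B [mB ->]] <-]].
exact: mf.
Qed.

Definition upd (i : nat) (v : nat -> R) (x : R) : seqsp :=
  fun k => if k == i then x else v k.

Lemma measurable_upd (i : nat) d (T : measurableType d) (f : T -> seqsp) (g : T -> R) :
  measurable_fun setT f -> measurable_fun setT g ->
  measurable_fun setT (fun t => upd i (f t) (g t)).
Proof.
move=> mf mg; apply: measurable_seqspP => k; rewrite /upd.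
case: eqP => // _; exact: (measurableT_comp (measurable_coord k) mf).
Qed.

End sequence_space.

Section nonmeasurable_integral.
Context d (T : measurableType d) (R : realType) (mu : {measure set T -> \bar R}).
Local Open Scope ereal_scope.
Import HBNNSimple.

(** The integral of a nonnegative function is a supremum over the simple functions below it, which
    makes sense for a nonmeasurable [F]. Each such simple function is below [G] almost
    everywhere. *)
Let ge0_integral_ae_nonmeasurable (F G : T -> \bar R) (Z : set T) :
  measurable Z -> mu Z = 0 -> measurable_fun setT G ->
  (forall x, 0 <= F x) -> (forall x, 0 <= G x) ->
  (forall x, ~ Z x -> F x = G x) ->
  \int[mu]_x F x = \int[mu]_x G x.
Proof.
move=> mZ Z0 mG F0 G0 FG.
have mZC : measurable (~` Z) by exact: measurableC.
apply/eqP; rewrite eq_le; apply/andP; split.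
  rewrite ge0_integralTE//; apply: ge_ereal_sup => _ [h hF <-].
  rewrite -integralT_nnsfun.
  apply: ae_ge0_le_integral => //.
  - by move=> x _; rewrite lee_fin.
  - exact/measurable_EFinP.
  exists Z; split => // x /= hx; apply: contrapT => nZ; apply: hx => _.
  by rewrite -FG//; exact: hF.
(* [G] set to zero on [Z] has the same integral and lies below [F] everywhere, so its simple
   minorants are minorants of [F]. *)
have -> : \int[mu]_x G x = \int[mu]_x (G \_ (~` Z)) x.
  apply: ge0_ae_eq_integral => //.
  - exact/(measurable_restrictT _ mZC)/measurable_funTS.
  - by move=> x _; rewrite patchE; case: ifP.
  exists Z; split => // x /= hx; apply: contrapT => nZ; apply: hx => _.
  by rewrite patchE mem_set.
rewrite ge0_integralTE; last by move=> x; rewrite patchE; case: ifP.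
rewrite ge0_integralTE//; apply: le_ereal_sup => _ [h hG <-].
exists h => // x; apply: le_trans (hG x) _; rewrite patchE; case: ifPn => //.
by rewrite inE => /FG ->.
Qed.

(* The library's [ae_eq_integral] asks that both functions be measurable. *)
Lemma integral_ae_nonmeasurable (F G : T -> \bar R) (Z : set T) :
  measurable Z -> mu Z = 0 -> measurable_fun setT G ->
  (forall x, ~ Z x -> F x = G x) ->
  \int[mu]_x F x = \int[mu]_x G x.
Proof.
move=> mZ Z0 mG FG; rewrite integralE [RHS]integralE; congr (_ - _).
  apply: (ge0_integral_ae_nonmeasurable mZ Z0) => //.
    exact: measurable_funepos.
  by move=> x /FG Fx; rewrite !funeposE Fx.
apply: (ge0_integral_ae_nonmeasurable mZ Z0) => //.
  exact: measurable_funeneg.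
by move=> x /FG Fx; rewrite !funenegE Fx.
Qed.

End nonmeasurable_integral.

Section gaussian_measure.
Variables (R : realType) (s : R).
Local Notation V := (seqsp R).
Local Open Scope ereal_scope.

Definition updp (N : nat) (p : measurableTypeR R * V) : V := upd N p.2 p.1.

Lemma measurable_updp N : measurable_fun setT (updp N).
Proof. by apply: measurable_upd; [exact: measurable_snd|exact: measurable_fst]. Qed.

HB.instance Definition _ N := isMeasurableFun.Build _ _ _ _ (updp N) (measurable_updp N).

(** The recursion copies that of [gauss_iter]: the newest coordinate [N'] is integrated outermost,
    and the coordinates from [N] on vanish. *)
Fixpoint gamma (N : nat) : probability V R :=
  if N is N'.+1 then
    distribution (normal_prob 0 s \x gamma N') (updp N')
  else \d_((fun=> 0%R) : V).

Lemma ge0_integral_gammaS N (f : V -> \bar R) :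
  measurable_fun setT f -> (forall v, 0 <= f v) ->
  \int[gamma N.+1]_v f v = \int[normal_prob 0 s]_x \int[gamma N]_v f (upd N v x).
Proof.
move=> mf f0 /=.
rewrite ge0_integral_distribution// fubini_tonelli1//; last by move=> x; exact: f0.
exact: measurableT_comp mf (@measurable_updp N).
Qed.

Lemma integrable_gammaS N (f : V -> \bar R) :
  measurable_fun setT f -> (gamma N.+1).-integrable setT f ->
  (normal_prob 0 s \x gamma N).-integrable setT (f \o updp N).
Proof.
move=> mf /integrableP[_ foo]; apply/integrableP; split.
  exact: measurableT_comp mf (@measurable_updp N).
by move: foo; rewrite ge0_integral_distribution//; exact: measurableT_comp.
Qed.

(** Induction on [N] through Fubini. Almost every section of [Z] is null and almost every section of
    [g] is integrable, so the possibly nonmeasurable [f] can be replaced by [g] one integration at a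
    time. *)
Lemma gauss_iterE N (f g : V -> R) (Z : set V) :
  measurable Z -> gamma N Z = 0 -> (forall v, ~ Z v -> f v = g v) ->
  measurable_fun setT g -> (gamma N).-integrable setT (EFin \o g) ->
  gauss_iter s N f = \int[gamma N]_v (g v)%:E.
Proof.
elim: N => [|N IHN] in f g Z * => mZ Z0 fg mg ig.
  rewrite /= integral_dirac//; last exact/measurable_EFinP.
  rewrite diracT mul1e fg// => Zv; move: Z0 => /=.
  by rewrite diracE mem_set// => /eqP; rewrite onee_eq0.
have mg' : measurable_fun setT (EFin \o g) by exact/measurable_EFinP.
have := integrable_gammaS mg' ig.
set h := _ \o _ => ih.
have [A [mA A0 hA]] := ae_integrable1 ih.
have mZp : measurable (updp N @^-1` Z).
  by rewrite -[X in measurable X]setTI; exact: measurable_updp.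
pose phi x := gamma N (xsection (updp N @^-1` Z) x).
have mphi : measurable_fun setT phi by exact: measurable_fun_xsection.
(* The measure of the section at [x] has integral [gamma N.+1 Z = 0], hence vanishes for almost
   every [x]. *)
have [B [mB B0 hB]] : {ae normal_prob 0 s, forall x, setT x -> phi x = cst 0 x}.
  apply/ae_eq_integral_abs => //.
  rewrite -[RHS]Z0 /= /distribution/pushforward /product_measure1/=.
  by apply: eq_integral => x _; rewrite gee0_abs.
pose AB := A `|` B.
have mAB : measurable AB by exact: measurableU.
have AB0 : normal_prob 0 s AB = 0 by exact: null_set_setU.
transitivity (\int[normal_prob 0 s]_x fubini_F (gamma N) h x).
  rewrite [LHS]/=; apply: (integral_ae_nonmeasurable mAB AB0).
    exact: measurable_fubini_F ih.
  move=> x /not_orP[nA nB]; rewrite /fubini_F.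
  have ix : (gamma N).-integrable setT (fun v => h (x, v)).
    by apply: contrapT => nh; apply/nA/hA.
  have zx : phi x = 0 by apply: contrapT => nh; apply/nB/hB => /(_ Logic.I).
  apply: (IHN _ (fun v => g (upd N v x)) (xsection (updp N @^-1` Z) x)) => //.
  - exact: measurable_xsection.
  - by move=> v nZ; apply: fg => Zv; apply: nZ; rewrite /xsection/= inE.
  - by apply: (measurableT_comp mg); apply: measurable_upd => //; exact: measurable_id.
rewrite integral12_prod_meas1//.
by rewrite /= integral_pushforward.
Qed.

End gaussian_measure.

(** * Rotation invariance *)

Section density.
Context d (T : measurableType d) (R : realType).
Variables (mu nu : {measure set T -> \bar R}) (p : T -> R).
Hypothesis mp : measurable_fun setT p.
Hypothesis p0 : forall x, 0 <= p x.
Local Open Scope ereal_scope.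
Hypothesis nuE : forall A, measurable A -> nu A = \int[mu]_(x in A) (p x)%:E.
Import HBNNSimple.

Let integral_density_nnsfun (f : {nnsfun T >-> R}) :
  \int[nu]_x (f x)%:E = \int[mu]_x ((f x)%:E * (p x)%:E).
Proof.
under [LHS]eq_integral do rewrite fimfunE -fsumEFin//.
rewrite [LHS]ge0_integral_fsum//; last 2 first.
  - by move=> r; exact/measurable_EFinP/measurableT_comp.
  - by move=> n x _; rewrite EFinM nnfun_muleindic_ge0.
under [RHS]eq_integral.
  move=> x xD; rewrite fimfunE -fsumEFin// muleC ge0_mule_fsumr; last first.
    by move=> r; rewrite EFinM nnfun_muleindic_ge0.
  over.
rewrite [RHS]ge0_integral_fsum//; last 2 first.
  - by move=> r; apply/measurable_EFinP; apply: measurable_funM => //; exact: measurable_funM.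
  - move=> n x _; rewrite EFinM mule_ge0//; last by rewrite nnfun_muleindic_ge0.
    by rewrite lee_fin.
apply: eq_fsbigr => r _.
have mr : measurable (f @^-1` [set r]) by [].
rewrite integralZl_indic_nnsfun// integral_indic// setIT nuE//.
have [r0|r0] := ltP r 0%R.
  rewrite preimage_nnfun0// integral_set0 mule0 integral0_eq// => x _.
  by rewrite indic0 mulr0 mule0.
under [RHS]eq_integral do rewrite EFinM muleCA.
rewrite ge0_integralZl//.
- congr (_ * _); rewrite integral_mkcond; apply: eq_integral => x _.
  by rewrite patchE indicE; case: (x \in _); rewrite ?mule1 ?mule0.
- by apply/measurable_EFinP; exact: measurable_funM.
- by move=> x _; rewrite lee_fin mulr_ge0.
Qed.

Lemma ge0_integral_density (f : T -> \bar R) :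
  measurable_fun setT f -> (forall x, 0 <= f x) ->
  \int[nu]_x f x = \int[mu]_x (f x * (p x)%:E).
Proof.
move=> mf f0.
pose f_ := nnsfun_approx measurableT mf.
transitivity (lim (\int[nu]_x (f_ n x)%:E @[n --> \oo])%E).
  rewrite -monotone_convergence//=.
  - apply: eq_integral => ? /[!inE] xD; apply/esym/cvg_lim => //=.
    exact: cvg_nnsfun_approx.
  - by move=> n; exact/measurable_EFinP/measurable_funTS.
  - by move=> n ? _; rewrite lee_fin.
  - by move=> ? _ ? ? mn; rewrite lee_fin; exact/lefP/nd_nnsfun_approx.
rewrite [RHS](_ : _ = lim
    (\int[mu]_x ((f_ n x)%:E * (p x)%:E) @[n --> \oo])%E); last first.
  rewrite -monotone_convergence//=.
  - apply: eq_integral => x /[!inE] xD; apply/esym/cvg_lim => //.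
    under eq_fun do rewrite muleC.
    rewrite muleC; apply: cvgeZl => //.
    exact: cvg_nnsfun_approx.
  - by move=> n; apply: emeasurable_funM; apply/measurable_EFinP.
  - by move=> n ? _; rewrite mule_ge0// lee_fin.
  - move=> x _ ? ? ?; rewrite lee_wpmul2r ?lee_fin//; exact/lefP/nd_nnsfun_approx.
by congr (lim (_ @ \oo)); apply/funext => n; exact: integral_density_nnsfun.
Qed.

End density.

Section lebesgue_plane.
Variable R : realType.
Local Open Scope ereal_scope.
Local Notation mu := (@lebesgue_measure R).

(** Lebesgue measure is determined by its values on half-open intervals, and a translation keeps
    their lengths. *)
Lemma ge0_integral_lebesgue_shift (a : R) (f : R -> \bar R) :
  measurable_fun setT f -> (forall x, 0 <= f x) ->
  \int[mu]_x f (x + a)%R = \int[mu]_x f x.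
Proof.
move=> mf f0.
pose phi (x : measurableTypeR R) : measurableTypeR R := (x + a)%R.
have mphi : measurable_fun setT phi by exact: measurable_funD.
rewrite -[LHS](ge0_integral_pushforward mphi mu (D := setT))//.
apply: eq_measure_integral => // A mA _; apply/esym/lebesgue_measure_unique => //.
move=> _ [[x y]] _ <-; rewrite /= /pushforward /preimage.
have -> : [set z | `]x, y]%classic (phi z)] = `](x - a)%R, (y - a)%R]%classic.
  by apply/seteqP; split => z /=; rewrite !in_itv/= ltrBlDr lerBrDr.
rewrite !lebesgue_measure_itv/= !lte_fin ltrD2r.
by case: ifP => // _; rewrite -!EFinD; congr EFin; ring.
Qed.

Lemma measurable_affine2 (a b : R) d (T : measurableType d) (g h : T -> R) :
  measurable_fun setT g -> measurable_fun setT h ->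
  measurable_fun setT (fun t => a * g t + b * h t)%R.
Proof. by move=> mg mh; apply: measurable_funD; apply: measurable_funM. Qed.

Let shear1 (a : R) (F : R -> R -> \bar R) :
  measurable_fun setT (fun p : R * R => F p.1 p.2) -> (forall x y, 0 <= F x y) ->
  \int[mu]_x \int[mu]_y F x (y + a * x)%R = \int[mu]_x \int[mu]_y F x y.
Proof.
move=> mF F0; apply: eq_integral => x _.
apply: (@ge0_integral_lebesgue_shift _ (F x)) => //.
exact: (measurableT_comp mF (pair1_measurable x)).
Qed.

(** Here Tonelli first exchanges the order of integration, so that the inner integral is again a
    translation. *)
Let shear2 (a : R) (F : R -> R -> \bar R) :
  measurable_fun setT (fun p : R * R => F p.1 p.2) -> (forall x y, 0 <= F x y) ->
  \int[mu]_x \int[mu]_y F (x + a * y)%R y = \int[mu]_x \int[mu]_y F x y.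
Proof.
move=> mF F0.
have mG : measurable_fun setT (fun p : R * R => F (p.1 + a * p.2)%R p.2).
  have mp : measurable_fun setT (fun p : R * R => (p.1 + a * p.2, p.2)%R).
    apply: measurable_fun_pair; last exact: measurable_snd.
    apply: measurable_funD; first exact: measurable_fst.
    by apply: measurable_funM => //; exact: measurable_snd.
  exact: (measurableT_comp mF mp).
apply: eq_trans _ (esym (@fubini_tonelli _ _ _ _ R mu mu _ mF (fun p => F0 p.1 p.2))).
apply: eq_trans (@fubini_tonelli _ _ _ _ R mu mu _ mG (fun p => F0 _ p.2)) _.
apply: eq_integral => y _ /=.
apply: (@ge0_integral_lebesgue_shift _ (F ^~ y)) => //.
exact: (measurableT_comp mF (pair2_measurable y)).
Qed.

(* A rotation by an angle different from [pi] is a product of three shears. *)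
Lemma ge0_integral_lebesgue_rotation (c t : R) (F : R -> R -> \bar R) :
  (c ^+ 2 + t ^+ 2 = 1)%R -> (0 < 1 + c)%R ->
  measurable_fun setT (fun p : R * R => F p.1 p.2) -> (forall x y, 0 <= F x y) ->
  \int[mu]_x \int[mu]_y F (c * x - t * y)%R (t * x + c * y)%R =
  \int[mu]_x \int[mu]_y F x y.
Proof.
(* With [c] and [t] the cosine and sine of an angle, [a] is the tangent of half of it. The shears
   are by [-a], [t], [-a] along alternating axes; [1 + c] vanishes exactly for the angle pi. *)
move=> ct1 c1 mF F0; pose a : R := (t / (1 + c))%R.
have ca : (a * (1 + c) = t)%R by rewrite /a divfK// gt_eqF.
have ta : (t * a = 1 - c)%R.
  apply: (mulIf (_ : 1 + c != 0)%R); first by rewrite gt_eqF.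
  rewrite -mulrA ca; rewrite -expr2; lra.
have mc (u v u' v' : R) : measurable_fun setT
    (fun p : R * R => F (u * p.1 + v * p.2)%R (u' * p.1 + v' * p.2)%R).
  have mG : measurable_fun setT
      (fun p : R * R => (u * p.1 + v * p.2, u' * p.1 + v' * p.2)%R).
    by apply: measurable_fun_pair; apply: measurable_affine2;
      [exact: measurable_fst|exact: measurable_snd|exact: measurable_fst|exact: measurable_snd].
  exact: (measurableT_comp mF mG).
apply: eq_trans _ (@shear2 (- a) F mF F0).
have m1 : measurable_fun setT (fun p : R * R => F (p.1 + - a * p.2)%R p.2).
  have := mc 1%R (- a)%R 0%R 1%R; congr measurable_fun.
  by apply/funext => p; rewrite !mul1r mul0r add0r.
apply: eq_trans _ (@shear1 t _ m1 (fun x y => F0 _ _)).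
have m2 : measurable_fun setT (fun p : R * R =>
    F (p.1 + - a * (p.2 + t * p.1))%R (p.2 + t * p.1)%R).
  have := mc (1 - a * t)%R (- a)%R t 1%R; congr measurable_fun.
  by apply/funext => p; congr F; ring.
apply: eq_trans _ (@shear2 (- a)%R
  (fun x y => F (x + - a * (y + t * x))%R (y + t * x)%R) m2 (fun x y => F0 _ _)).
apply: eq_integral => x _; apply: eq_integral => y _; congr F; last first.
  by rewrite mulrDr mulrA mulrN ta; ring.
rewrite mulrDr; have -> : (- a * (t * (x + - a * y)) = - (t * a) * x + (t * a) * a * y)%R by ring.
rewrite ta.
have -> : (x + - a * y + (- a * y + (- (1 - c) * x + (1 - c) * a * y)) =
  c * x - a * (1 + c) * y)%R by ring.
by rewrite ca.
Qed.

End lebesgue_plane.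

Section normal_plane.
Variables (R : realType) (s : R).
Hypothesis s0 : s != 0.
Local Open Scope ereal_scope.
Local Notation mu := (@lebesgue_measure R).
Local Notation P := (normal_prob 0 s : probability (measurableTypeR R) R).
Local Notation p := (normal_pdf 0 s).

Lemma ge0_integral_normal_prob (f : R -> \bar R) :
  measurable_fun setT f -> (forall x, 0 <= f x) ->
  \int[P]_x f x = \int[mu]_x (f x * (p x)%:E).
Proof.
move=> mf f0; apply: (ge0_integral_density (nu := P)) => //.
- exact: measurable_normal_pdf.
- by move=> x; exact: normal_pdf_ge0.
Qed.

Lemma ge0_integral_normal_prob2 (f : R -> R -> \bar R) :
  measurable_fun setT (fun q : R * R => f q.1 q.2) -> (forall x y, 0 <= f x y) ->
  \int[P]_x \int[P]_y f x y = \int[mu]_x \int[mu]_y (f x y * (p x * p y)%:E).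
Proof.
move=> mf f0.
have mfx x : measurable_fun setT (f x).
  exact: (measurableT_comp mf (pair1_measurable x)).
have mI : measurable_fun setT (fun x => \int[P]_y f x y).
  exact: (@measurable_fun_fubini_tonelli_F _ _ _ _ R P _ mf (fun p => f0 p.1 p.2)).
rewrite ge0_integral_normal_prob//; last by move=> x; exact: integral_ge0.
apply: eq_integral => x _.
rewrite ge0_integral_normal_prob// -ge0_integralZr//.
- by apply: eq_integral => y _; rewrite -muleA -EFinM mulrC.
- apply: emeasurable_funM; first exact: mfx.
  by apply/measurable_EFinP; exact: measurable_normal_pdf.
- by move=> y _; rewrite mule_ge0// lee_fin normal_pdf_ge0.
- by rewrite lee_fin normal_pdf_ge0.
Qed.

(** The density [p x * p y] depends only on [x^2 + y^2], which the rotation keeps, so the claim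
    reduces to Lebesgue measure. *)
Lemma ge0_integral_normal_rotation (c t : R) (f : R -> R -> \bar R) :
  (c ^+ 2 + t ^+ 2 = 1)%R -> (0 < 1 + c)%R ->
  measurable_fun setT (fun q : R * R => f q.1 q.2) -> (forall x y, 0 <= f x y) ->
  \int[P]_x \int[P]_y f (c * x - t * y)%R (t * x + c * y)%R =
  \int[P]_x \int[P]_y f x y.
Proof.
move=> ct1 c1 mf f0.
pose F x y := f x y * (p x * p y)%:E.
have mpp : measurable_fun setT (fun q : R * R => (p q.1 * p q.2)%:E).
  apply/measurable_EFinP; apply: measurable_funM.
    exact: measurableT_comp (measurable_normal_pdf 0 s) measurable_fst.
  exact: measurableT_comp (measurable_normal_pdf 0 s) measurable_snd.
have mF : measurable_fun setT (fun q : R * R => F q.1 q.2) by exact: emeasurable_funM.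
have F0 x y : 0 <= F x y by rewrite mule_ge0// lee_fin mulr_ge0 ?normal_pdf_ge0.
apply: eq_trans _ (esym (ge0_integral_normal_prob2 mf f0)).
apply: eq_trans _ (ge0_integral_lebesgue_rotation ct1 c1 mF F0).
have mrot : measurable_fun setT (fun q : R * R => f (c * q.1 - t * q.2)%R (t * q.1 + c * q.2)%R).
  have mG : measurable_fun setT
      (fun q : R * R => (c * q.1 - t * q.2, t * q.1 + c * q.2)%R).
    apply: measurable_fun_pair.
      have := @measurable_affine2 R c (- t) _ _ fst snd measurable_fst measurable_snd.
      by congr measurable_fun; apply/funext => q; rewrite mulNr.
    exact: measurable_affine2 measurable_fst measurable_snd.
  exact: (measurableT_comp mf mG).
apply: eq_trans (ge0_integral_normal_prob2 mrot (fun x y => f0 _ _)) _.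
apply: eq_integral => x _; apply: eq_integral => y _; rewrite /F; congr (_ * _%:E).
rewrite normal_pdfE// /normal_fun mulrACA [RHS]mulrACA; congr (_ * _)%R.
rewrite -!expRD; congr expR; rewrite !subr0 -!mulrDl; congr (_ / _)%R.
have -> : (- x ^+ 2 + - y ^+ 2 = - ((c ^+ 2 + t ^+ 2) * (x ^+ 2 + y ^+ 2)))%R.
  by rewrite ct1; ring.
by ring.
Qed.

Lemma ge0_integral_normalN (f : R -> \bar R) :
  measurable_fun setT f -> (forall x, 0 <= f x) ->
  \int[P]_x f (- x)%R = \int[P]_x f x.
Proof.
move=> mf f0.
pose N (x : measurableTypeR R) : measurableTypeR R := (- x)%R.
have mN : measurable_fun setT N by exact: oppr_measurable.
rewrite ge0_integral_normal_prob//; last exact: (measurableT_comp mf mN).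
rewrite [RHS]ge0_integral_normal_prob//.
have mfp : measurable_fun setT (fun x => f x * (p x)%:E).
  by apply: emeasurable_funM => //; apply/measurable_EFinP; exact: measurable_normal_pdf.
have fp0 x : 0 <= f x * (p x)%:E by rewrite mule_ge0// lee_fin normal_pdf_ge0.
transitivity (\int[mu]_x ((fun x => f x * (p x)%:E) \o N) x).
  apply: eq_integral => x _ /=; congr (_ * _%:E).
  by rewrite normal_pdfE// /normal_fun /N !subr0 sqrrN.
rewrite -[LHS](ge0_integral_pushforward mN mu (D := setT))//.
by apply: eq_measure_integral => // A mA _; exact: lebesgue_measureN.
Qed.

(* The bound [1 + l x^2 <= exp (l x^2)] turns the law into a normal law of standard
   deviation [s (1 + e)], for a suitable [l]; then [e] goes to [0]. *)
Lemma normal_moment2 : \int[P]_x (x ^+ 2)%:E <= (s ^+ 2)%:E.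
Proof.
have mX2 : measurable_fun setT (fun x : R => (x ^+ 2)%:E).
  by apply/measurable_EFinP; exact: exprn_measurable.
have bound (e : R) : (0 < e)%R ->
    (2 * e + e ^+ 2)%:E * \int[P]_x (x ^+ 2)%:E <=
    (s ^+ 2 * (1 + e) ^+ 2 * (2 * e))%:E.
  move=> e0.
  have e1 : (0 < 1 + e)%R by lra.
  have se0 : (s * (1 + e) != 0)%R by rewrite mulf_neq0// gt_eqF.
  (* The value for which [exp (l x^2)] times the density of deviation [s] is proportional to the
     density of deviation [s (1 + e)]; the ratio of the peaks contributes the mass [1 + e]. *)
  pose l : R := ((2 * e + e ^+ 2) / (2 * (s ^+ 2 * (1 + e) ^+ 2)))%R.
  have D0 : (0 < 2 * (s ^+ 2 * (1 + e) ^+ 2))%R.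
    by rewrite mulr_gt0// mulr_gt0 ?(exprn_gt0 2 e1)// exprn_even_gt0.
  have l0 : (0 <= l)%R by apply: divr_ge0; [nra|exact: ltW].
  have key : \int[P]_x (1 + l%:E * (x ^+ 2)%:E) <= (1 + e)%:E.
    have -> : (1 + e)%:E = \int[mu]_x ((1 + e)%:E * (normal_pdf 0 (s * (1 + e)) x)%:E).
      rewrite ge0_integralZl//.
      - by rewrite integral_normal_pdf mule1.
      - by apply/measurable_EFinP; exact: measurable_normal_pdf.
      - by move=> x _; rewrite lee_fin normal_pdf_ge0.
      - by rewrite lee_fin ltW.
    rewrite ge0_integral_normal_prob//; last 2 first.
    - by apply: emeasurable_funD => //; apply: emeasurable_funM.
    - by move=> x; rewrite adde_ge0// mule_ge0// lee_fin ?sqr_ge0.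
    apply: ge0_le_integral => //.
    - by move=> x _; rewrite mule_ge0 ?adde_ge0 ?mule_ge0 ?lee_fin ?normal_pdf_ge0 ?sqr_ge0.
    - apply: emeasurable_funM; first by apply: emeasurable_funD => //; apply: emeasurable_funM.
      by apply/measurable_EFinP; exact: measurable_normal_pdf.
    - by apply: emeasurable_funM => //; apply/measurable_EFinP; exact: measurable_normal_pdf.
    move=> x _; rewrite -!EFinM lee_fin !normal_pdfE//.
    have -> : normal_peak (s * (1 + e)) = (normal_peak s / (1 + e))%R.
      rewrite /normal_peak exprMn -mulrnAr mulrAC sqrtrM; last first.
        by rewrite mulr_ge0 ?sqr_ge0// mulrn_wge0 ?pi_ge0.
      by rewrite sqrtr_sqr gtr0_norm// invfM mulrnAr.
    rewrite mulrCA [leRHS]mulrA [((1 + e) * _)%R]mulrC divfK ?gt_eqF// ler_pM2l ?normal_peak_gt0//.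
    have -> : normal_fun 0 (s * (1 + e)) x = (expR (l * x ^+ 2) * normal_fun 0 s x)%R.
      rewrite /normal_fun -expRD !subr0.
      have a0 : (1 + e != 0)%R by rewrite gt_eqF.
      by congr expR; rewrite /l; field; rewrite s0 a0.
    by rewrite ler_wpM2r ?normal_fun_ge0// expR_ge1Dx.
  move: key; rewrite ge0_integralD//; last 2 first.
  - by move=> x _; rewrite mule_ge0// lee_fin sqr_ge0.
  - by apply: emeasurable_funM.
  rewrite ge0_integralZl//; last by move=> x _; rewrite lee_fin sqr_ge0.
  rewrite integral_cst// [X in 1 * X](probability_setT P) mule1 (EFinD 1 e) leeD2lE// => key.
  have -> : (2 * e + e ^+ 2 = 2 * (s ^+ 2 * (1 + e) ^+ 2) * l)%R.
    by rewrite /l [RHS]mulrC divfK// gt_eqF.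
  rewrite EFinM -muleA; apply: le_trans (lee_wpmul2l _ key) _; first by rewrite lee_fin ltW.
  rewrite -EFinM lee_fin le_eqVlt; apply/orP; left; apply/eqP; ring.
(* The bound for [e = 1] excludes an infinite moment. *)
have fin : \int[P]_x (x ^+ 2)%:E \is a fin_num.
  have I0 : 0 <= \int[P]_x (x ^+ 2)%:E by apply: integral_ge0 => x _; rewrite lee_fin sqr_ge0.
  rewrite ge0_fin_numE//; have := bound 1%R ltr01.
  case: (\int[P]_x _) I0 => //= [r _ _|_]; first exact: ltry.
  by rewrite gt0_muley// lte_fin; lra.
rewrite -(fineK fin) lee_fin; set m := fine _.
have {}bound (e : R) : (0 < e -> m <= s ^+ 2 * (1 + e) ^+ 2)%R.
  move=> e0; have := bound _ e0; rewrite -(fineK fin) -/m -EFinM lee_fin => h.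
  have ee : (0 < 2 * e + e ^+ 2)%R by rewrite addr_gt0 ?mulr_gt0 ?exprn_gt0.
  rewrite -(ler_pM2l ee); apply: le_trans h _.
  by rewrite mulrC; apply: ler_wpM2r; [rewrite mulr_ge0 ?sqr_ge0|rewrite lerDl sqr_ge0].
rewrite leNgt; apply/negP => hm.
have s2 : (0 < s ^+ 2)%R by rewrite exprn_even_gt0.
(* As [e <= 1], [s^2 (1 + e)^2 <= s^2 + 3 s^2 e], which is less than [s^2 + 4 s^2 e <= m]: this
   contradicts the bound. *)
pose e := (Num.min 1 ((m - s ^+ 2) / (4 * s ^+ 2)))%R.
have s4 : (0 < 4 * s ^+ 2)%R by rewrite pmulr_rgt0.
have e0 : (0 < e)%R by rewrite lt_min ltr01/= divr_gt0 ?subr_gt0.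
have e1 : (e <= 1)%R by rewrite ge_min lexx.
have e2 : (4 * s ^+ 2 * e <= m - s ^+ 2)%R.
  by rewrite mulrC -ler_pdivlMr// ge_min lexx orbT.
have := bound _ e0.
have : (s ^+ 2 * e ^+ 2 <= s ^+ 2 * e)%R by rewrite ler_pM2l// expr2 ler_piMl// ltW.
have : (0 < s ^+ 2 * e)%R by rewrite (pmulr_rgt0 _ s2).
by nra.
Qed.

End normal_plane.

Section gaussian_invariance.
Variables (R : realType) (s : R).
Hypothesis s0 : s != 0.
Local Open Scope ereal_scope.
Local Notation V := (seqsp R).
Local Notation P := (normal_prob 0 s : probability (measurableTypeR R) R).
Local Notation gamma := (gamma s).

Lemma upd_upd i (v : V) x y : upd i (upd i v x) y = upd i v y.
Proof. by apply/funext => k; rewrite /upd; case: eqP. Qed.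

Lemma updC i j (v : V) x y : i != j -> upd i (upd j v x) y = upd j (upd i v y) x.
Proof.
move=> ij; apply/funext => k; rewrite /upd; case: (k =P i) => [->|//].
by rewrite (negbTE ij).
Qed.

Lemma measurable_upd_r i (v : V) : measurable_fun setT (upd i v).
Proof. by apply: measurable_upd => //; exact: measurable_id. Qed.

Lemma measurable_upd_l i x : measurable_fun setT (fun v : V => upd i v x).
Proof. by apply: measurable_upd => //; exact: measurable_id. Qed.

Lemma measurable_upd2 i : measurable_fun setT (fun p : V * measurableTypeR R => upd i p.1 p.2).
Proof. by apply: measurable_upd; [exact: measurable_fst|exact: measurable_snd]. Qed.

Lemma measurable_integral_upd i (f : V -> \bar R) :
  measurable_fun setT f -> (forall v, 0 <= f v) ->
  measurable_fun setT (fun v : V => \int[P]_x f (upd i v x)).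
Proof.
move=> mf f0.
have m2 : measurable_fun setT (fun p : V * measurableTypeR R => f (upd i p.1 p.2)).
  exact: (measurableT_comp mf (measurable_upd2 i)).
exact: (@measurable_fun_fubini_tonelli_F _ _ _ _ R P _ m2 (fun p => f0 _)).
Qed.

(** Redrawing an independent coordinate does not change the law. This gives access to a coordinate
    at any position, whereas the recursion of [gamma] exposes the last one. *)
Lemma ge0_integral_gamma_resample N i (f : V -> \bar R) : (i < N)%N ->
  measurable_fun setT f -> (forall v, 0 <= f v) ->
  \int[gamma N]_v f v = \int[gamma N]_v \int[P]_x f (upd i v x).
Proof.
elim: N => [|N IHN] in f * => // iN mf f0.
have mI := measurable_integral_upd i mf f0.
have I0 v : 0 <= \int[P]_x f (upd i v x) by exact: integral_ge0.
apply: eq_trans (ge0_integral_gammaS s N mf f0) _.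
apply: eq_trans _ (esym (ge0_integral_gammaS s N mI I0)).
have [iN'|] := ltnP i N.
  apply: eq_integral => y _.
  apply: eq_trans (IHN _ iN' (measurableT_comp mf (measurable_upd_l N y)) (fun v => f0 _)) _.
  apply: eq_integral => v _; apply: eq_integral => x _.
  by rewrite /= updC// gtn_eqF.
move=> Ni; have -> : i = N by apply/eqP; rewrite eqn_leq Ni -ltnS iN.
have m2 : measurable_fun setT (fun p : measurableTypeR R * V => f (upd N p.2 p.1)).
  exact: (measurableT_comp mf (@measurable_updp R N)).
apply: eq_trans (@fubini_tonelli _ _ _ _ R P (gamma N) _ m2 (fun p => f0 _)) _.
transitivity (\int[P]_y cst (\int[gamma N]_v \int[P]_x f (upd N v x)) y).
  by rewrite integral_cst// [X in _ * X](probability_setT P) mule1.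
apply: eq_integral => y _; apply: eq_integral => v _; apply: eq_integral => x _.
by rewrite upd_upd.
Qed.

(** Tested on nonnegative functions, to which Tonelli applies without an integrability condition;
    [preserves_integral] extends it to signed functions. *)
Definition preserves N (T : V -> V) := measurable_fun setT T /\
  forall f : V -> \bar R, measurable_fun setT f -> (forall v, 0 <= f v) ->
  \int[gamma N]_v f (T v) = \int[gamma N]_v f v.

Lemma preserves_id N : preserves N id.
Proof. by split => //; exact: measurable_id. Qed.

Lemma preserves_comp N T1 T2 : preserves N T1 -> preserves N T2 ->
  preserves N (T1 \o T2).
Proof.
move=> [m1 p1] [m2 p2]; split; first exact: measurableT_comp.
move=> f mf f0.
have -> := p2 (f \o T1) (measurableT_comp mf m1) (fun v => f0 _).
exact: p1.
Qed.

Definition flip i (v : V) : V := upd i v (- v i)%R.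

Lemma preserves_flip N i : (i < N)%N -> preserves N (flip i).
Proof.
move=> iN.
have mflip : measurable_fun setT (flip i).
  apply: measurable_upd; first exact: measurable_id.
  by apply: measurableT_comp => //; exact: measurable_coord.
split=> // f mf f0.
apply: eq_trans (ge0_integral_gamma_resample iN (measurableT_comp mf mflip) (fun v => f0 _)) _.
apply: eq_trans _ (esym (ge0_integral_gamma_resample iN mf f0)).
apply: eq_integral => v _.
have mu := measurableT_comp mf (measurable_upd_r i v).
apply: eq_trans _ (ge0_integral_normalN s0 mu (fun x => f0 _)).
by apply: eq_integral => x _; rewrite /flip /= upd_upd /upd eqxx.
Qed.

Definition givens i j (c t : R) (v : V) : V :=
  upd j (upd i v (c * v i - t * v j)%R) (t * v i + c * v j)%R.

Lemma measurable_givens i j c t : measurable_fun setT (givens i j c t).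
Proof.
apply: measurable_upd; first apply: measurable_upd; first exact: measurable_id.
- have := @measurable_affine2 R c (- t) _ _ _ _ (@measurable_coord R i) (@measurable_coord R j).
  by congr measurable_fun; apply/funext => q; rewrite mulNr.
- exact: measurable_affine2 (@measurable_coord R i) (@measurable_coord R j).
Qed.

(** Redraw the coordinates [i] and [j]: with all others frozen, the claim is the rotation invariance
    of the normal law in the plane. *)
Lemma preserves_givens N i j c t : (i < N)%N -> (j < N)%N -> i != j ->
  (c ^+ 2 + t ^+ 2 = 1)%R -> (0 < 1 + c)%R -> preserves N (givens i j c t).
Proof.
move=> iN jN ij ct c1; split; first exact: measurable_givens.
move=> f mf f0.
have step h : measurable_fun setT h -> (forall v, 0 <= h v) ->
    \int[gamma N]_v h v =
    \int[gamma N]_v \int[P]_x \int[P]_y h (upd j (upd i v x) y).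
  move=> mh h0; apply: eq_trans (ge0_integral_gamma_resample jN mh h0) _.
  apply: (ge0_integral_gamma_resample iN (measurable_integral_upd j mh h0)).
  by move=> v; exact: integral_ge0.
apply: eq_trans (step _ (measurableT_comp mf (measurable_givens i j c t)) (fun v => f0 _)) _.
apply: eq_trans _ (esym (step f mf f0)).
apply: eq_integral => v _.
pose h x y := f (upd j (upd i v x) y).
have mh : measurable_fun setT (fun q : R * R => h q.1 q.2).
  have mG : measurable_fun setT (fun q : R * R => upd j (upd i v q.1) q.2).
    apply: measurable_upd; last exact: measurable_snd.
    by apply: measurable_upd => //; exact: measurable_fst.
  exact: (measurableT_comp mf mG).
apply: eq_trans _ (ge0_integral_normal_rotation s0 ct c1 mh (fun x y => f0 _)).
apply: eq_integral => x _; apply: eq_integral => y _; rewrite /h /= /givens.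
have -> : upd j (upd i v x) y i = x by rewrite /upd (negbTE ij) eqxx.
have -> : upd j (upd i v x) y j = y by rewrite /upd eqxx.
by rewrite (updC _ _ _ ij) !upd_upd.
Qed.

Local Close Scope ereal_scope.

Definition dot N (u v : nat -> R) : R := \sum_(k < N) u k * v k.

Lemma dot_givens N i j c t u v : (i < N)%N -> (j < N)%N -> i != j ->
  c ^+ 2 + t ^+ 2 = 1 -> dot N (givens i j c t u) (givens i j c t v) = dot N u v.
Proof.
move=> iN jN ij ct; pose I := Ordinal iN; pose J := Ordinal jN.
have JI : J != I by rewrite -val_eqE eq_sym.
rewrite /dot (bigD1 I)//= (bigD1 J)//= [RHS](bigD1 I)//= [in RHS](bigD1 J)//=.
rewrite !addrA; congr (_ + _).
  rewrite /givens /upd eqxx (negbTE ij) eqxx.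
  transitivity ((c ^+ 2 + t ^+ 2) * (u i * v i + u j * v j)); first by ring.
  by rewrite ct mul1r.
apply: eq_bigr => k /andP[kI kJ].
rewrite -!val_eqE/= in kI kJ.
by rewrite /givens /upd (negbTE kJ) (negbTE kI).
Qed.

Definition householder N (u v : V) : V :=
  fun k => v k - 2 * (dot N u v / dot N u u) * u k.

Lemma givensK i j c t : i != j -> c ^+ 2 + t ^+ 2 = 1 ->
  cancel (givens i j c t) (givens i j c (- t)).
Proof.
move=> ij ct v; apply/funext => k; rewrite /givens /upd (negbTE ij) !eqxx.
case: (k =P j) => [->|_].
  transitivity ((c ^+ 2 + t ^+ 2) * v j); first by ring.
  by rewrite ct mul1r.
case: (k =P i) => [->|//].
transitivity ((c ^+ 2 + t ^+ 2) * v i); first by ring.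
by rewrite ct mul1r.
Qed.

(** A rotation preserves [dot], hence conjugates reflections into reflections; this allows [u] to be
    replaced by a rotated vector with more zeros. *)
Lemma givens_householder N i j c t u v : (i < N)%N -> (j < N)%N -> i != j ->
  c ^+ 2 + t ^+ 2 = 1 ->
  householder N (givens i j c t u) (givens i j c t v) = givens i j c t (householder N u v).
Proof.
move=> iN jN ij ct; rewrite /householder !dot_givens//.
apply/funext => k; rewrite /givens /upd; set q := 2 * _.
by case: (k =P j) => [_|_]; [|case: (k =P i) => _//]; ring.
Qed.

(* Givens rotations cancel the coordinates of [u] one after the other, until
   the reflection is a change of sign of one coordinate. *)
Lemma preserves_householder N (u : V) : (forall k, (N <= k)%N -> u k = 0) ->
  preserves N (householder N u).
Proof.
have [n] := ubnP #|[pred k : 'I_N | u k != 0]|.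
elim: n u => // n IHn u un uN.
have [u0|nu0] := pselect (forall i : 'I_N, u i = 0).
  rewrite (_ : householder N u = id); first exact: preserves_id.
  apply/funext => v; apply/funext => k; rewrite /householder.
  have [kN|/uN ->] := ltnP k N; last by rewrite mulr0 subr0.
  by rewrite (u0 (Ordinal kN)) mulr0 subr0.
have [i /eqP ui] : exists i : 'I_N, u i <> 0 by exact/existsNP.
have [uj|] := pselect (forall j : 'I_N, j != i -> u j = 0).
  rewrite (_ : householder N u = flip i); first exact: preserves_flip.
  apply/funext => v; apply/funext => k; rewrite /householder /flip /upd.
  have dotE w : dot N u w = u i * w i.
    rewrite /dot (bigD1 i)//= big1 ?addr0// => j ji.
    by rewrite uj// mul0r.
  rewrite !dotE; case: (k =P i) => [->|ki]; first by field.
  have [kN|/uN ->] := ltnP k N; last by rewrite mulr0 subr0.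
  by rewrite (uj (Ordinal kN)) ?mulr0 ?subr0//; apply/eqP => /(congr1 val).
move=> /existsNP[j /not_implyP[ji /eqP uj]].
pose r := Num.sqrt (u i ^+ 2 + u j ^+ 2).
have r2 : r ^+ 2 = u i ^+ 2 + u j ^+ 2 by rewrite sqr_sqrtr// addr_ge0 ?sqr_ge0.
have r0 : 0 < r by rewrite sqrtr_gt0 ltr_pwDl ?sqr_ge0// exprn_even_gt0.
(* The rotation in the plane of [i] and [j] that cancels [u j]. The sign of [u i] is moved into [t]
   so that [c >= 0], which keeps [1 + c] positive as the shears require. *)
pose c := `|u i| / r; pose t := - (Num.sg (u i) * u j) / r.
have c0 : 0 < 1 + c by rewrite ltr_pwDl// divr_ge0// ltW.
have sg2 : Num.sg (u i) ^+ 2 = 1 by rewrite sqr_sg ui.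
have ct : c ^+ 2 + t ^+ 2 = 1.
  rewrite !expr_div_n sqrrN exprMn sg2 mul1r real_normK ?num_real// -mulrDl -r2 divff//.
  by rewrite expf_neq0// gt_eqF.
have ij : val i != val j by rewrite val_eqE eq_sym.
pose g := givens i j c t.
have gj : g u j = 0.
  by rewrite /g /givens /upd eqxx /c /t normrEsg; ring.
have pg : preserves N g by exact: preserves_givens.
have pg' : preserves N (givens i j c (- t)) by apply: preserves_givens => //; rewrite sqrrN.
have pH : preserves N (householder N (g u)).
  apply: IHn.
    rewrite ltnS in un; apply: leq_trans _ un; apply: proper_card; apply/properP; split.
      apply/fintype.subsetP => k; rewrite !inE; apply: contra_neq => uk.
      rewrite /g /givens /upd.
      have [kj|_] := eqVneq (val k) (val j); first by case/eqP: uj; rewrite -kj uk.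
      have [ki|//] := eqVneq (val k) (val i); by case/eqP: ui; rewrite -ki uk.
    by exists j; rewrite !inE ?gj ?eqxx.
  move=> k Nk; rewrite /g /givens /upd.
  by rewrite !gtn_eqF ?uN//; apply: leq_trans Nk; exact: ltn_ord.
rewrite (_ : householder N u = givens i j c (- t) \o (householder N (g u) \o g)).
  by apply: preserves_comp => //; exact: preserves_comp.
by apply/funext => v /=; rewrite givens_householder// givensK.
Qed.

End gaussian_invariance.

(** * Polar decomposition *)

Section adjoint.
Import spectral.
Variable R : realType.
Local Notation C := R[i].
Local Notation Re := (@complex.Re R).
Local Notation Im := (@complex.Im R).
Local Notation conj := (@conjc R).

Lemma creD (x y : C) : Re (x + y) = Re x + Re y.
Proof. by case: x; case: y. Qed.

Lemma creN (x : C) : Re (- x) = - Re x.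
Proof. by case: x. Qed.

Lemma cimD (x y : C) : Im (x + y) = Im x + Im y.
Proof. by case: x; case: y. Qed.

Lemma creM (x y : C) : Re (x * y) = Re x * Re y - Im x * Im y.
Proof. by case: x; case: y. Qed.

Lemma cimM (x y : C) : Im (x * y) = Re x * Im y + Im x * Re y.
Proof. by case: x; case: y. Qed.

Lemma cre_sum I (r : seq I) (P : pred I) (F : I -> C) :
  Re (\sum_(i <- r | P i) F i) = \sum_(i <- r | P i) Re (F i).
Proof. exact: (big_morph Re creD erefl). Qed.

Lemma cim_sum I (r : seq I) (P : pred I) (F : I -> C) :
  Im (\sum_(i <- r | P i) F i) = \sum_(i <- r | P i) Im (F i).
Proof. exact: (big_morph Im cimD erefl). Qed.

Lemma creZ (a : R) (x : C) : Re (a%:C%C * x) = a * Re x.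
Proof. by rewrite creM /= mul0r subr0. Qed.

Lemma adjmxE m n (A : 'M[C]_(m, n)) i j : adjmx A i j = conj (A j i).
Proof. by rewrite !mxE. Qed.

Lemma adjmxK m n (A : 'M[C]_(m, n)) : adjmx (adjmx A) = A.
Proof. by apply/matrixP => i j; rewrite !adjmxE conjcK. Qed.

Lemma adjmxM m n p (A : 'M[C]_(m, n)) (B : 'M[C]_(n, p)) :
  adjmx (A *m B) = adjmx B *m adjmx A.
Proof. by rewrite /adjmx map_mxM trmx_mul. Qed.

Lemma adjmxD m n (A B : 'M[C]_(m, n)) : adjmx (A + B) = adjmx A + adjmx B.
Proof. by rewrite /adjmx map_mxD linearD. Qed.

Lemma adjmxN m n (A : 'M[C]_(m, n)) : adjmx (- A) = - adjmx A.
Proof. by rewrite /adjmx map_mxN linearN. Qed.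

Lemma adjmxB m n (A B : 'M[C]_(m, n)) : adjmx (A - B) = adjmx A - adjmx B.
Proof. by rewrite adjmxD adjmxN. Qed.

Lemma adjmxZ m n a (A : 'M[C]_(m, n)) : adjmx (a *: A) = conj a *: adjmx A.
Proof. by rewrite /adjmx map_mxZ linearZ. Qed.

Lemma adjmx1 n : adjmx (1%:M : 'M[C]_n) = 1%:M.
Proof. by rewrite /adjmx map_mx1 trmx1. Qed.

Lemma adjmx0 m n : adjmx (0 : 'M[C]_(m, n)) = 0.
Proof. by rewrite /adjmx map_mx0 trmx0. Qed.

Definition rtr n (A : 'M[C]_n) : R := Re (\tr A).

Lemma rtrD n (A B : 'M[C]_n) : rtr (A + B) = rtr A + rtr B.
Proof. by rewrite /rtr mxtraceD creD. Qed.

Lemma rtrN n (A : 'M[C]_n) : rtr (- A) = - rtr A.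
Proof. by rewrite /rtr linearN creN. Qed.

Lemma rtrB n (A B : 'M[C]_n) : rtr (A - B) = rtr A - rtr B.
Proof. by rewrite rtrD rtrN. Qed.

Lemma rtrC m n (A : 'M[C]_(m, n)) (B : 'M[C]_(n, m)) : rtr (A *m B) = rtr (B *m A).
Proof. by rewrite /rtr mxtrace_mulC. Qed.

Lemma rtrZ n a (A : 'M[C]_n) : rtr (a%:C%C *: A) = a * rtr A.
Proof. by rewrite /rtr linearZ/= creZ. Qed.

Lemma mxtrace_adjmx n (A : 'M[C]_n) : \tr (adjmx A) = conj (\tr A).
Proof. by rewrite /mxtrace rmorph_sum; apply: eq_bigr => i _; rewrite adjmxE. Qed.

Lemma rtr_adjmx n (A : 'M[C]_n) : rtr (adjmx A) = rtr A.
Proof. by rewrite /rtr mxtrace_adjmx; case: (\tr A). Qed.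

Lemma rtr_sqr m n (A : 'M[C]_(m, n)) :
  rtr (A *m adjmx A) = \sum_i \sum_j (Re (A i j) ^+ 2 + Im (A i j) ^+ 2).
Proof.
rewrite /rtr /mxtrace cre_sum; apply: eq_bigr => i _; rewrite mxE cre_sum.
apply: eq_bigr => j _; rewrite adjmxE creM; case: (A i j) => a b /=.
by rewrite mulrN opprK !expr2.
Qed.

Lemma rtr_sqr_ge0 m n (A : 'M[C]_(m, n)) : 0 <= rtr (A *m adjmx A).
Proof. by rewrite rtr_sqr; do 2 (apply: sumr_ge0 => ? _); rewrite addr_ge0 ?sqr_ge0. Qed.

Lemma rtr_sqr_eq0 m n (A : 'M[C]_(m, n)) : rtr (A *m adjmx A) = 0 -> A = 0.
Proof.
rewrite rtr_sqr => /psumr_eq0P h; apply/matrixP => i j; rewrite mxE.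
have h0 (k : 'I_m) (l : 'I_n) : 0 <= Re (A k l) ^+ 2 + Im (A k l) ^+ 2.
  by rewrite addr_ge0 ?sqr_ge0.
have /psumr_eq0P hi := h (fun k _ => sumr_ge0 _ (fun l _ => h0 k l)) i isT.
have /eqP := hi (fun l _ => h0 i l) j isT.
rewrite paddr_eq0 ?sqr_ge0// !sqrf_eq0 => /andP[/eqP a /eqP b].
by apply/eqP; rewrite eq_complex a b eqxx.
Qed.

Lemma frobCE m n (A : 'M[C]_(m, n)) : frobC A = Num.sqrt (rtr (A *m adjmx A)).
Proof. by rewrite rtr_sqr. Qed.

Lemma unitaryP d (Q : 'M[C]_d) : unitary Q <-> adjmx Q *m Q = 1%:M.
Proof. by split => /mulmx1C. Qed.

Lemma unitaryM d (P Q : 'M[C]_d) : unitary P -> unitary Q -> unitary (P *m Q).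
Proof.
move=> hP hQ; rewrite /unitary adjmxM mulmxA -(mulmxA P).
by rewrite (hQ : _ = _) mulmx1.
Qed.

Lemma unitary_adjmx d (Q : 'M[C]_d) : unitary Q -> unitary (adjmx Q).
Proof. by rewrite /unitary adjmxK => /mulmx1C. Qed.

Lemma unitary1 d : unitary (1%:M : 'M[C]_d).
Proof. by rewrite /unitary adjmx1 mulmx1. Qed.

Lemma unitary_unitmx d (Q : 'M[C]_d) : unitary Q -> Q \in unitmx.
Proof. by move=> /mulmx1_unit[]. Qed.

Lemma rtr1 d : rtr (1%:M : 'M[C]_d) = d%:R.
Proof. by rewrite /rtr mxtrace1; elim: d => // k IH; rewrite !mulrS creD IH. Qed.

Lemma frobC_unitary d (Z X : 'M[C]_d) : unitary Z ->
  rtr ((Z - X) *m adjmx (Z - X)) = d%:R + rtr (X *m adjmx X) - 2 * rtr (adjmx X *m Z).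
Proof.
move=> hZ; rewrite adjmxB mulmxBl !mulmxBr (hZ : _ = _) !rtrB.
have -> : rtr (X *m adjmx Z) = rtr (adjmx X *m Z).
  by rewrite -rtr_adjmx adjmxM adjmxK rtrC.
by rewrite rtr1 (rtrC Z); ring.
Qed.

(** For unitary [Z] the distance to [X] depends on [Z] only through [Re tr (X^H Z)]. With
    [W = Q^H Z] unitary, [(1 - W) (1 - W)^H = 2 - W - W^H], so the excess over the distance from [Q]
    is a square. Minimality and uniqueness of [Q] both follow. *)
Lemma frobC_polar d (Q T Z : 'M[C]_d) (X := Q *m (adjmx T *m T)) :
  unitary Q -> unitary Z ->
  rtr ((Z - X) *m adjmx (Z - X)) =
  rtr ((Q - X) *m adjmx (Q - X)) +
  rtr ((T *m (1%:M - adjmx Q *m Z)) *m adjmx (T *m (1%:M - adjmx Q *m Z))).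
Proof.
move=> hQ hZ; rewrite !frobC_unitary//.
set W := adjmx Q *m Z.
have hW : W *m adjmx W = 1%:M by apply: unitaryM => //; exact: unitary_adjmx.
have E Y : rtr (adjmx X *m Y) = rtr (T *m (adjmx Q *m Y) *m adjmx T).
  by rewrite /X !adjmxM adjmxK -!mulmxA rtrC !mulmxA.
rewrite !E (proj1 (unitaryP Q) hQ) -/W.
have WW : (1%:M - W) *m (1%:M - adjmx W) = 1%:M + 1%:M - W - adjmx W.
  by rewrite mulmxBl mul1mx mulmxBr hW mulmx1 opprB addrA (addrAC 1%:M) addrAC.
rewrite adjmxM adjmxB adjmx1 mulmxA -(mulmxA T (1%:M - W)) WW.
rewrite !mulmxBr mulmxDr !mulmxBl mulmxDl mulmx1 !rtrB rtrD.
have -> : rtr (T *m adjmx W *m adjmx T) = rtr (T *m W *m adjmx T).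
  by rewrite -rtr_adjmx !adjmxM !adjmxK mulmxA.
by ring.
Qed.

Lemma frobC_polar_min d (Q T Z : 'M[C]_d) (X := Q *m (adjmx T *m T)) :
  unitary Q -> unitary Z -> frobC (Q - X) <= frobC (Z - X).
Proof.
move=> hQ hZ; rewrite !frobCE ler_sqrt ?rtr_sqr_ge0//.
by rewrite (frobC_polar T hQ hZ) lerDl rtr_sqr_ge0.
Qed.

Lemma frobC_polar_unique d (Q T Z : 'M[C]_d) (X := Q *m (adjmx T *m T)) :
  unitary Q -> T \in unitmx -> unitary Z -> frobC (Z - X) <= frobC (Q - X) -> Z = Q.
Proof.
move=> hQ hT hZ; rewrite !frobCE ler_sqrt ?rtr_sqr_ge0//.
rewrite (frobC_polar T hQ hZ) gerDl => h.
have /rtr_sqr_eq0 : rtr (T *m (1%:M - adjmx Q *m Z) *m adjmx (T *m (1%:M - adjmx Q *m Z))) = 0.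
  by apply/eqP; rewrite eq_le h rtr_sqr_ge0.
move=> /(congr1 (mulmx (invmx T))); rewrite mulKmx// mulmx0 => /eqP.
rewrite subr_eq0 => /eqP /(congr1 (mulmx Q)).
by rewrite mulmx1 mulmxA (hQ : _ = _) mul1mx.
Qed.

(** The minimiser is unique, so the arbitrary choice made by [xget] is forced. *)
Lemma projU_polar d (Q T : 'M[C]_d) : unitary Q -> T \in unitmx ->
  projU (Q *m (adjmx T *m T)) = Q.
Proof.
move=> hQ hT; apply: xget_unique.
  by split => // Z hZ; exact: frobC_polar_min.
move=> Z [hZ hmin]; apply: (frobC_polar_unique hQ hT hZ); exact: hmin.
Qed.

Definition rdiag d (e : 'I_d -> R) : 'M[C]_d := diag_mx (\row_i (e i)%:C%C).

Lemma adjmx_rdiag d (e : 'I_d -> R) : adjmx (rdiag e) = rdiag e.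
Proof.
apply/matrixP => i j; rewrite adjmxE !mxE; case: eqP => [->|/eqP ij].
  by rewrite eqxx !mulr1n conjc_real.
by rewrite eq_sym (negbTE ij) !mulr0n conjc0.
Qed.

Lemma rdiagM d (e f : 'I_d -> R) : rdiag e *m rdiag f = rdiag (fun i => e i * f i).
Proof. by rewrite mulmx_diag; congr diag_mx; apply/rowP => i; rewrite !mxE rmorphM. Qed.

Lemma rdiag1 d : rdiag (fun _ : 'I_d => 1) = 1%:M.
Proof. by apply/matrixP => i j; rewrite !mxE. Qed.

Lemma rtr_rdiag d (e : 'I_d -> R) : rtr (rdiag e) = \sum_i e i.
Proof. by rewrite /rtr mxtrace_diag cre_sum; apply: eq_bigr => i _; rewrite mxE. Qed.

(** The spectral theorem gives [X^H X = P^H D P] with [D] positive, and [e] is the square root of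
    [D]. The factors are grouped as a unitary matrix times a positive Hermitian one, the polar form
    from which [projU] is read off. *)
Lemma svd d (X : 'M[C]_d) : X \in unitmx ->
  exists Q P (e : 'I_d -> R), [/\ unitary Q, unitary P, forall i, 0 < e i &
    X = Q *m (adjmx P *m rdiag e *m P)].
Proof.
move=> hX; pose H := adjmx X *m X.
have adjE m n (A : 'M[C]_(m, n)) : adjmx A = map_mx Num.conj A^T by rewrite -map_trmx.
have hH : H \is hermsymmx.
  apply/is_hermitianmxP; rewrite expr0 scale1r -adjE.
  by rewrite /H adjmxM adjmxK.
have hN := hermitian_normalmx hH.
have hr := hermitian_spectral_diag_real hH.
pose P := spectralmx H; pose D := spectral_diag H.
have hP : unitary P by rewrite /unitary adjE; apply/unitarymxP; exact: spectral_unitarymx.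
have PV : invmx P = adjmx P by rewrite adjE; apply: invmx_unitary; exact: spectral_unitarymx.
have HE : H = adjmx P *m diag_mx D *m P by rewrite -PV; exact/orthomx_spectralP.
pose l i := Re (D 0 i).
have DE : diag_mx D = rdiag l.
  by congr diag_mx; apply/rowP => i; rewrite mxE RRe_real//; exact: (mxOverP hr).
have lE i : (rdiag l) i i = ((row i (P *m adjmx X)) *m adjmx (row i (P *m adjmx X))) 0 0.
  have : P *m H *m adjmx P = rdiag l.
    by rewrite HE DE !mulmxA (hP : _ = _) mul1mx -mulmxA (hP : _ = _) mulmx1.
  move=> /matrixP /(_ i i) <-; rewrite /H mulmxA -mulmxA -(adjmxK (X *m adjmx P)).
  by rewrite [adjmx (X *m _)]adjmxM adjmxK -row_mul !mxE; apply: eq_bigr => j _; rewrite !mxE.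
(* An eigenvalue is the squared norm of a row of the invertible matrix [P X^H]. *)
have l0 i : 0 < l i.
  have h : l i = rtr ((row i (P *m adjmx X)) *m adjmx (row i (P *m adjmx X))).
    by rewrite /rtr /mxtrace big_ord1 -lE !mxE eqxx.
  rewrite lt_def {2}h rtr_sqr_ge0 andbT; apply/eqP => li0.
  have /rtr_sqr_eq0 : rtr ((row i (P *m adjmx X)) *m adjmx (row i (P *m adjmx X))) = 0.
    by rewrite -h.
  have uPX : P *m adjmx X \in unitmx.
    by rewrite unitmx_mul unitary_unitmx// unitmx_tr map_unitmx.
  rewrite rowE => /(congr1 (mulmx^~ (invmx (P *m adjmx X)))).
  rewrite mulmxK// mul0mx => /matrixP /(_ 0 i); rewrite !mxE !eqxx => /eqP.
  by rewrite oner_eq0.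
pose e i := Num.sqrt (l i).
have e0 i : 0 < e i by rewrite sqrtr_gt0.
have ee : rdiag e *m rdiag e = rdiag l.
  by rewrite rdiagM; congr diag_mx; apply/rowP => i; rewrite !mxE -expr2 sqr_sqrtr// ltW.
pose e' i := (e i)^-1.
have e'e : rdiag e' *m rdiag e = 1%:M.
  rewrite rdiagM -rdiag1; congr diag_mx; apply/rowP => i.
  by rewrite !mxE mulVf// gt_eqF.
have ee' : rdiag e *m rdiag e' = 1%:M by exact: mulmx1C.
(* The unitary factor is [X] times the inverse square root of [X^H X]. *)
exists (X *m (adjmx P *m rdiag e' *m P)), P, e; split => //.
- apply/unitaryP; rewrite !adjmxM adjmxK adjmx_rdiag.
  rewrite -!mulmxA (mulmxA (adjmx X)) -/H HE DE -ee !mulmxA.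
  rewrite -(mulmxA _ P (adjmx P)) (hP : _ = _) mulmx1.
  rewrite -(mulmxA _ P (adjmx P)) (hP : _ = _) mulmx1.
  rewrite -(mulmxA _ (rdiag e') (rdiag e)) e'e mulmx1 -(mulmxA _ (rdiag e) (rdiag e')) ee' mulmx1.
  exact/unitaryP.
- rewrite -!mulmxA (mulmxA P (adjmx P)) (hP : _ = _) mul1mx (mulmxA (rdiag e')) e'e mul1mx.
  by rewrite (proj1 (unitaryP P) hP) mulmx1.
Qed.

(** Puts the positive factor into the shape [T^H T] on which [frobC_polar] rests. *)
Lemma rdiag_square d (P : 'M[C]_d) (e : 'I_d -> R) : unitary P ->
  (forall i, 0 < e i) ->
  exists2 T, T \in unitmx & adjmx P *m rdiag e *m P = adjmx T *m T.
Proof.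
move=> hP e0; exists (rdiag (fun i => Num.sqrt (e i)) *m P).
  rewrite unitmx_mul (unitary_unitmx hP) andbT.
  suff /mulmx1_unit[] : rdiag (fun i => Num.sqrt (e i)) *m
      rdiag (fun i => (Num.sqrt (e i))^-1) = 1%:M by [].
  rewrite rdiagM -rdiag1; congr diag_mx; apply/rowP => i.
  by rewrite !mxE divff// gt_eqF// sqrtr_gt0.
have ss : rdiag (fun i => Num.sqrt (e i)) *m rdiag (fun i => Num.sqrt (e i)) = rdiag e.
  rewrite rdiagM; congr diag_mx; apply/rowP => i.
  by rewrite !mxE -expr2 sqr_sqrtr// ltW.
by rewrite adjmxM adjmx_rdiag -!mulmxA (mulmxA (rdiag _) (rdiag _)) ss.
Qed.

Lemma projU_svd d (Q P : 'M[C]_d) (e : 'I_d -> R) : unitary Q -> unitary P ->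
  (forall i, 0 < e i) -> projU (Q *m (adjmx P *m rdiag e *m P)) = Q.
Proof. by move=> hQ hP e0; have [T hT ->] := rdiag_square hP e0; exact: projU_polar. Qed.

Lemma projU_min d (X Z : 'M[C]_d) : X \in unitmx -> unitary Z ->
  frobC (projU X - X) <= frobC (Z - X).
Proof.
move=> /svd[Q [P [e [hQ hP e0 ->]]]] hZ; rewrite projU_svd//.
by have [T hT ->] := rdiag_square hP e0; exact: frobC_polar_min.
Qed.

Lemma projU_unique d (X Z : 'M[C]_d) : X \in unitmx -> unitary Z ->
  frobC (Z - X) <= frobC (projU X - X) -> Z = projU X.
Proof.
move=> /svd[Q [P [e [hQ hP e0 ->]]]] hZ; rewrite projU_svd//.
by have [T hT ->] := rdiag_square hP e0; exact: frobC_polar_unique.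
Qed.

(** Conjugating the factors of a polar form gives a polar form of the conjugate. Hence an invertible
    matrix with real entries has a real projection. *)
Lemma projU_conj d (X : 'M[C]_d) : X \in unitmx ->
  projU (map_mx conj X) = map_mx conj (projU X).
Proof.
have adjc m n (A : 'M[C]_(m, n)) : map_mx conj (adjmx A) = adjmx (map_mx conj A).
  by rewrite /adjmx -map_trmx.
have uc (A : 'M[C]_d) : unitary A -> unitary (map_mx conj A).
  by rewrite /unitary -adjc -map_mxM => ->; rewrite map_mx1.
move=> /svd[Q [P [e [hQ hP e0 ->]]]]; rewrite projU_svd// !map_mxM adjc.
have -> : map_mx conj (rdiag e) = rdiag e.
  by rewrite -[RHS]adjmx_rdiag /adjmx map_trmx /rdiag tr_diag_mx.
by rewrite projU_svd//; exact: uc.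
Qed.

Lemma unitary_projU d (X : 'M[C]_d) : X \in unitmx -> unitary (projU X).
Proof. by move=> /svd[Q [P [e [hQ hP e0 ->]]]]; rewrite projU_svd. Qed.

Lemma projU_unitaryl d (U X : 'M[C]_d) : unitary U -> X \in unitmx ->
  projU (U *m X) = U *m projU X.
Proof.
move=> hU /svd[Q [P [e [hQ hP e0 ->]]]]; rewrite mulmxA !projU_svd//.
exact: unitaryM.
Qed.

Lemma projU_hermitian d (X : 'M[C]_d) : X \in unitmx ->
  adjmx (projU X *m adjmx X) = projU X *m adjmx X.
Proof.
move=> /svd[Q [P [e [hQ hP e0 ->]]]]; rewrite projU_svd//.
by rewrite !adjmxM !adjmxK adjmx_rdiag !mulmxA.
Qed.

Lemma char_poly_unitary_conj d (P A : 'M[C]_d) : unitary P ->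
  char_poly (adjmx P *m A *m P) = char_poly A.
Proof.
move=> hP; pose p := map_mx (@polyC C).
have pP : p _ _ (adjmx P) *m p _ _ P = 1%:M.
  by rewrite -map_mxM (proj1 (unitaryP P) hP) map_mx1.
rewrite /char_poly.
have -> : char_poly_mx (adjmx P *m A *m P) = p _ _ (adjmx P) *m char_poly_mx A *m p _ _ P.
  rewrite /char_poly_mx mulmxBr mulmxBl -!map_mxM; congr (_ - _).
  by rewrite scalar_mxC -mulmxA pP mulmx1.
by rewrite !det_mulmx mulrAC -det_mulmx pP det1 mul1r.
Qed.

(** With [X = Q (P^H e P)] both sides are the sum of the [e i]. The list in [singvalsC] is a choice,
    but its squares are the roots of a characteristic polynomial and its entries are nonnegative,
    which fixes it up to order. *)
Lemma sum_singvalsC d (X : 'M[C]_d) : X \in unitmx ->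
  \sum_(x <- singvalsC X) x = rtr (projU X *m adjmx X).
Proof.
move=> /svd[Q [P [e [hQ hP e0 XE]]]].
have -> : rtr (projU X *m adjmx X) = \sum_i e i.
  rewrite XE projU_svd// !adjmxM !adjmxK adjmx_rdiag rtrC -!mulmxA.
  rewrite (proj1 (unitaryP Q) hQ) mulmx1 rtrC -mulmxA (hP : _ = _) mulmx1.
  exact: rtr_rdiag.
have XX : adjmx X *m X = adjmx P *m rdiag (fun i => e i ^+ 2) *m P.
  rewrite XE !adjmxM !adjmxK adjmx_rdiag -!mulmxA (mulmxA (adjmx Q)).
  rewrite (proj1 (unitaryP Q) hQ) mul1mx (mulmxA P (adjmx P)) (hP : _ = _) mul1mx.
  by rewrite (mulmxA (rdiag e)) rdiagM.
have cE : char_poly (adjmx X *m X) = \prod_i ('X - ((e i ^+ 2)%:C%C)%:P).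
  rewrite XX char_poly_unitary_conj// char_poly_trig ?diag_mx_is_trig//.
  by apply: eq_bigr => i _; rewrite !mxE eqxx.
pose s0 := [seq e i | i <- enum 'I_d].
rewrite /singvalsC; set S := [set s | _].
have S0 : S s0.
  split; first by rewrite size_map size_enum_ord.
  split; first by apply/allP => _ /mapP[i _ ->]; rewrite ltW.
  by rewrite cE big_map big_enum.
have [_ [sp sc]] : S (xget [::] S) by exact: xgetI S0.
set s := xget _ _ in sp sc *.
have : perm_eq [seq (x ^+ 2)%:C%C | x <- s] [seq (x ^+ 2)%:C%C | x <- s0].
  by apply: prod_XsubC_eq; rewrite big_map -sc cE /s0 !big_map.
move=> /(perm_map (fun z => Num.sqrt (Re z))); rewrite -(map_comp _ _ s) -(map_comp _ _ s0).
have sqK t : all (fun x => 0 <= x) t ->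
    [seq ((fun z => Num.sqrt (Re z)) \o (fun x => (x ^+ 2)%:C%C)) x | x <- t] = t :> seq R.
  move=> /allP ht; rewrite -[RHS]map_id; apply/eq_in_map => x xt /=.
  by rewrite sqrtr_sqr ger0_norm// ht.
have [_ [sp0 _]] := S0; rewrite !sqK//.
by move=> hp; rewrite (perm_big s0 hp) big_map big_enum.
Qed.

End adjoint.

Section real_matrices.
Variable R : realType.
Local Notation C := R[i].
Local Notation emb := (map_mx (real_complex R)).

Lemma adjmx_emb m n (A : 'M[R]_(m, n)) : adjmx (emb A) = emb A^T.
Proof. by apply/matrixP => i j; rewrite !mxE conjc_real. Qed.

Lemma rtr_emb n (A : 'M[R]_n) : rtr (emb A) = \tr A.
Proof. by rewrite /rtr /mxtrace cre_sum; apply: eq_bigr => i _; rewrite mxE. Qed.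

Lemma emb_inj m n : injective (emb : 'M[R]_(m, n) -> _).
Proof. exact: map_mx_inj. Qed.

Lemma unitary_emb d (Q : 'M[R]_d) : unitary (emb Q) <-> orthogonal Q.
Proof.
rewrite /unitary /orthogonal adjmx_emb -map_mxM; split => [|->]; last by rewrite map_mx1.
by rewrite -(map_mx1 (real_complex R)) => /emb_inj.
Qed.

Lemma frobC_emb m n (A : 'M[R]_(m, n)) : frobC (emb A) = frobR A.
Proof.
congr Num.sqrt; apply: eq_bigr => i _; apply: eq_bigr => j _.
by rewrite !mxE /= expr0n addr0.
Qed.

(** The complex projection of a real matrix is invariant under conjugation, hence real; being the
    unique minimiser over all unitary matrices, it is also the unique one over the orthogonal
    matrices. *)
Lemma emb_projO d (X : 'M[R]_d) : X \in unitmx -> emb (projO X) = projU (emb X).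
Proof.
move=> hX; have hE : emb X \in unitmx by rewrite map_unitmx.
pose Z := map_mx (@complex.Re R) (projU (emb X)).
have ZE : emb Z = projU (emb X).
  have : map_mx (@conjc R) (projU (emb X)) = projU (emb X).
    rewrite -projU_conj//; congr projU.
    by apply/matrixP => i j; rewrite !mxE conjc_real.
  move=> /matrixP h; apply/matrixP => i j; move: (h i j); rewrite !mxE.
  case: (projU _ i j) => a b [] /eqP; rewrite -subr_eq0 -opprD oppr_eq0.
  by rewrite -mulr2n mulrn_eq0 => /eqP ->.
have hZ : orthogonal Z by apply/unitary_emb; rewrite ZE; exact: unitary_projU.
suff -> : projO X = Z by [].
have frE W : frobR (W - X) = frobC (emb W - emb X) by rewrite -map_mxB frobC_emb.
apply: xget_unique.
  by split => // W /unitary_emb hW; rewrite !frE ZE; exact: projU_min.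
move=> W [hW hmin]; apply: emb_inj; rewrite ZE; apply: projU_unique => //.
  exact/unitary_emb.
by rewrite -ZE -!frE; exact: hmin.
Qed.

Lemma singvalsR_emb d (X : 'M[R]_d) : singvalsR X = singvalsC (emb X).
Proof.
rewrite /singvalsR /singvalsC; congr xget; apply/seteqP.
have E (s : seq R) : (char_poly (X^T *m X) = \prod_(x <- s) ('X - (x ^+ 2)%:P)) <->
    (char_poly (adjmx (emb X) *m emb X) = \prod_(x <- s) ('X - ((x ^+ 2)%:C%C)%:P)).
  rewrite adjmx_emb -map_mxM -map_char_poly.
  have -> : \prod_(x <- s) ('X - ((x ^+ 2)%:C%C)%:P) =
      map_poly (real_complex R) (\prod_(x <- s) ('X - (x ^+ 2)%:P)).
    by rewrite rmorph_prod; apply: eq_bigr => x _; rewrite rmorphB/= map_polyX map_polyC.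
  by split => [->//|]; exact: map_poly_inj.
by split => s [h1 [h2 /E h3]].
Qed.

End real_matrices.

(** * Complex reflections and their action on orthonormal rows *)

Section reflections.
Variable R : realType.
Local Notation C := R[i].

(* The field of scalars: the reals inside [C] if [b] is true, [C] otherwise. *)
Definition scal (b : bool) : {pred C} := fun z => b ==> (z \is Num.real).

Fact scal_divring b : divring_closed (scal b).
Proof.
by case: b; split => //=; rewrite /in_mem/= ?rpred1//; move=> x y; rewrite /in_mem/= /scal/=;
  [exact: rpredB|exact: rpred_div].
Qed.
HB.instance Definition _ b := GRing.isDivringClosed.Build C (scal b) (scal_divring b).

Lemma scal_conj b (z : C) : z \in scal b -> conjc z \in scal b.
Proof.
rewrite /in_mem/= /scal; case: b => //=; case: z => x y.
by rewrite !complex_real oppr_eq0.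
Qed.

Definition scalmx b m n (A : 'M[C]_(m, n)) := A \is a mxOver (scal b).

Lemma scalmxM b m n p (A : 'M[C]_(m, n)) (B : 'M[C]_(n, p)) :
  scalmx b A -> scalmx b B -> scalmx b (A *m B).
Proof. exact: mxOverM. Qed.

Lemma scalmxD b m n (A B : 'M[C]_(m, n)) : scalmx b A -> scalmx b B -> scalmx b (A + B).
Proof. exact: rpredD. Qed.

Lemma scalmxB b m n (A B : 'M[C]_(m, n)) : scalmx b A -> scalmx b B -> scalmx b (A - B).
Proof. exact: rpredB. Qed.

Lemma scalmx1 b n : scalmx b (1%:M : 'M[C]_n).
Proof. by apply/mxOverP => i j; rewrite mxE rpred_nat. Qed.

Lemma scalmx_adj b m n (A : 'M[C]_(m, n)) : scalmx b A -> scalmx b (adjmx A).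
Proof. by move=> /mxOverP h; apply/mxOverP => i j; rewrite adjmxE scal_conj. Qed.

Lemma scalmxZ b m n a (A : 'M[C]_(m, n)) : a \in scal b -> scalmx b A -> scalmx b (a *: A).
Proof. exact: mxOverZ. Qed.

(** A reflection with a complex parameter, unitary when [c + conjc c = v v^H]; real [c] is the
    Householder case. The extra phase allows a unit row [u] to be sent to a unit row [e] even if
    [u e^H] is not real. *)
Definition refl N (v : 'rV[C]_N) (c : C) : 'M[C]_N := 1%:M - c^-1 *: (adjmx v *m v).

Lemma mulmx_refl N m (w : 'M[C]_(m, N)) v c :
  w *m refl v c = w - c^-1 *: (w *m adjmx v *m v).
Proof. by rewrite mulmxBr mulmx1 -scalemxAr mulmxA. Qed.

Lemma refl_unitary N (v : 'rV[C]_N) c : c != 0 ->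
  c + conjc c = (v *m adjmx v) 0 0 -> unitary (refl v c).
Proof.
move=> c0 cc; have c0' : conjc c != 0 by rewrite conjc_eq0.
rewrite /unitary /refl adjmxB adjmx1 adjmxZ adjmxM adjmxK conjc_inv.
set P := adjmx v *m v.
have PP : P *m P = (c + conjc c) *: P.
  by rewrite /P -mulmxA (mulmxA v) (mx11_scalar (v *m _)) -cc mul_scalar_mx -scalemxAr.
rewrite mulmxBl mul1mx mulmxBr mulmx1 -!scalemxAl -scalemxAr PP -addrA -opprD.
rewrite -[RHS]subr0; congr (_ - _); rewrite !scalerA -scalerBl -scalerDl.
suff -> : (conjc c)^-1 + (c^-1 - c^-1 / conjc c * (c + conjc c)) = 0.
  by rewrite scale0r.
by field; rewrite c0 c0'.
Qed.

Lemma scalmx_refl b N (v : 'rV[C]_N) c : scalmx b v -> c \in scal b -> scalmx b (refl v c).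
Proof.
move=> hv hc; apply: scalmxB; first exact: scalmx1.
apply: scalmxZ; first by rewrite rpredV.
by apply: scalmxM => //; exact: scalmx_adj.
Qed.

Lemma row_mul_adj m N (A : 'M[C]_(m, N)) i j :
  (row i A *m adjmx (row j A)) 0 0 = (A *m adjmx A) i j.
Proof. by rewrite !mxE; apply: eq_bigr => k _; rewrite !mxE. Qed.

(** The rows are moved to the standard basis one at a time. The predicate [S] is left abstract so
    that the same induction can record that the product preserves the Gaussian law, or that it comes
    from a real matrix. *)
Lemma reflections_to_pid b d N (M : 'M[C]_(d, N)) (S : 'M[C]_N -> Prop) :
  (d <= N)%N -> M *m adjmx M = 1%:M -> scalmx b M -> S 1%:M ->
  (forall Q v c, S Q -> scalmx b v -> c \in scal b -> c != 0 ->
     c + conjc c = (v *m adjmx v) 0 0 -> S (Q *m refl v c)) ->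
  exists Q, [/\ S Q, unitary Q, scalmx b Q & M *m Q = pid_mx d].
Proof.
move=> dN MM hM S1 Sr.
have main m : (m <= d)%N -> exists Q, [/\ S Q, unitary Q, scalmx b Q &
    forall i : 'I_d, (i < m)%N -> row i (M *m Q) = delta_mx 0 (widen_ord dN i)].
  elim: m => [_|m IHm md].
    by exists 1%:M; split => //; [exact: unitary1|exact: scalmx1].
  have [Q [SQ uQ hQ rQ]] := IHm (ltnW md).
  pose im := Ordinal md; pose u := row im (M *m Q).
  pose e : 'rV[C]_N := delta_mx 0 (widen_ord dN im).
  have MQ : (M *m Q) *m adjmx (M *m Q) = 1%:M.
    by rewrite adjmxM mulmxA -(mulmxA M) (uQ : _ = _) mulmx1.
  have hMQ : scalmx b (M *m Q) by exact: scalmxM.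
  have subE (A B : 'M[C]_1) : (A - B) 0 0 = A 0 0 - B 0 0 by rewrite !mxE.
  have eE k : e 0 k = (k == widen_ord dN im)%:R by rewrite mxE eqxx.
  have ue : (u *m adjmx e) 0 0 = u 0 (widen_ord dN im).
    rewrite mxE (bigD1 (widen_ord dN im))//= big1 ?addr0 => [|k kn].
      by rewrite adjmxE eE eqxx conjc1 mulr1.
    by rewrite adjmxE eE (negbTE kn) conjc0 mulr0.
  have uu : (u *m adjmx u) 0 0 = 1 by rewrite row_mul_adj MQ mxE eqxx.
  have [ve|ve] := eqVneq u e.
    exists Q; split => // i; rewrite ltnS leq_eqVlt => /orP[/eqP im'|]; last exact: rQ.
    by have -> : i = im by exact: val_inj.
  (* This [c] equals [u v^H], so the reflection takes [u] to [u - v = e]; for unit rows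
     [c + conjc c] is the squared norm of [u - e]. *)
  pose v := u - e; pose c := 1 - (u *m adjmx e) 0 0.
  have hv : scalmx b v.
    apply: scalmxB; apply/mxOverP => i j; rewrite mxE; first exact: (mxOverP hMQ).
    exact: rpred_nat.
  have hc : c \in scal b.
    by rewrite rpredB ?rpred1// ue mxE; exact: (mxOverP hMQ).
  have cc : c + conjc c = (v *m adjmx v) 0 0.
    have ee : (e *m adjmx e) 0 0 = 1.
      rewrite mxE (bigD1 (widen_ord dN im))//= big1 ?addr0 => [|k kn].
        by rewrite adjmxE eE eqxx conjc1 mulr1.
      by rewrite eE (negbTE kn) mul0r.
    have eu : (e *m adjmx u) 0 0 = conjc ((u *m adjmx e) 0 0).
      by rewrite -adjmxE adjmxM adjmxK.
    rewrite /v adjmxB mulmxBl !mulmxBr !subE uu ee eu.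
    by rewrite /c rmorphB rmorph1; ring.
  have c0 : c != 0.
    apply: contra_neq ve => c0; apply/eqP; rewrite -subr_eq0; apply/eqP.
    apply: rtr_sqr_eq0; rewrite /rtr /mxtrace big_ord1 -/v -cc c0.
    by rewrite conjc0 addr0.
  exists (Q *m refl v c); split.
  - exact: Sr.
  - by apply: unitaryM => //; exact: refl_unitary.
  - by apply: scalmxM => //; exact: scalmx_refl.
  have rr i : row i (M *m (Q *m refl v c)) =
      row i (M *m Q) - c^-1 *: ((row i (M *m Q) *m adjmx v) 0 0 *: v).
    by rewrite mulmxA row_mul mulmx_refl [X in X *m v]mx11_scalar mul_scalar_mx.
  move=> i; rewrite ltnS leq_eqVlt => /orP[/eqP im'|im'].
    have -> : i = im by exact: val_inj.
    rewrite rr -/u [X in _ *: (X *: _)](_ : _ = c).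
      by rewrite scalerA mulVf// scale1r /v opprB addrC subrK.
    by rewrite /v adjmxB mulmxBr subE uu.
  (* An earlier row is a basis vector other than [e] and is orthogonal to [u], hence to [v]: the
     reflection leaves it alone. *)
  rewrite rr [X in _ *: (X *: _)](_ : _ = 0); first by rewrite scale0r scaler0 subr0; exact: rQ.
  have -> : (row i (M *m Q) *m adjmx v) 0 0 =
      (row i (M *m Q) *m adjmx u) 0 0 - (row i (M *m Q) *m adjmx e) 0 0.
    by rewrite /v adjmxB mulmxBr subE.
  have -> : (row i (M *m Q) *m adjmx u) 0 0 = 0.
    rewrite row_mul_adj MQ mxE; case: eqP => // ii.
    by move: im'; rewrite ii ltnn.
  rewrite rQ//.
  rewrite sub0r; apply/eqP; rewrite oppr_eq0; apply/eqP.
  rewrite mxE big1// => k _; rewrite adjmxE !mxE !eqxx/=.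
  have [->|_] := eqVneq k (widen_ord dN i); last by rewrite mul0r.
  by rewrite -val_eqE/= (ltn_eqF im') conjc0 mulr0.
have [Q [SQ uQ hQ rQ]] := main d (leqnn d).
exists Q; split => //; apply/row_matrixP => i; rewrite rQ//.
by apply/rowP => j; rewrite !mxE eqxx/= ltn_ord andbT -val_eqE eq_sym.
Qed.

End reflections.

(** * Gaussian matrices *)

Section orthogonal_action.
Variables (R : realType) (s : R).
Hypothesis s0 : s != 0.
Local Notation V := (seqsp R).
Local Notation emb := (map_mx (real_complex R)).

Definition act N (O : 'M[R]_N) (v : V) : V :=
  fun k => if insub k is Some i then \sum_j O i j * v j else v k.

Lemma actE N (O : 'M[R]_N) v (i : 'I_N) : act O v i = \sum_j O i j * v j.
Proof. by rewrite /act valK. Qed.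

Lemma act_ge N (O : 'M[R]_N) v k : (N <= k)%N -> act O v k = v k.
Proof. by move=> Nk; rewrite /act insubF// ltnNge Nk. Qed.

Lemma eq_act N (O : 'M[R]_N) (v w : V) : (forall i : 'I_N, \sum_j O i j * v j = w i) ->
  (forall k, (N <= k)%N -> v k = w k) -> act O v = w.
Proof.
move=> h1 h2; apply/funext => k; have [kN|Nk] := ltnP k N.
  by rewrite -[k]/(val (Ordinal kN)) actE h1.
by rewrite act_ge// h2.
Qed.

Lemma act1 N v : act (1%:M : 'M[R]_N) v = v.
Proof.
apply: eq_act => // i; rewrite (bigD1 i)//= big1 ?addr0 => [|j ji].
  by rewrite mxE eqxx mul1r.
by rewrite mxE eq_sym (negbTE ji) mul0r.
Qed.

Lemma act_comp N (A B : 'M[R]_N) v : act A (act B v) = act (A *m B) v.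
Proof.
apply: eq_act => [i|k Nk]; last by rewrite !act_ge.
rewrite actE; under eq_bigr do rewrite actE mulr_sumr.
rewrite exchange_big/=; apply: eq_bigr => j _.
by rewrite mxE mulr_suml; apply: eq_bigr => k _; rewrite mulrA.
Qed.

Lemma measurable_act N (O : 'M[R]_N) : measurable_fun setT (act O).
Proof.
apply: measurable_seqspP => k; rewrite /act; case: insubP => [i _ _|_]; last first.
  exact: measurable_coord.
by apply: measurable_sum => j; apply: measurable_funM => //; exact: measurable_coord.
Qed.

(** Bringing the rows of [O] to the standard basis produces a product [A] of real reflections with
    [O A = 1]. Each reflection preserves the law, hence so do [A] and its inverse [O]. *)
Lemma preserves_act N (O : 'M[R]_N) : O *m O^T = 1%:M -> preserves s N (act O).
Proof.
move=> OO; pose S (Q : 'M[R[i]]_N) := exists2 A : 'M[R]_N, Q = emb A & preserves s N (act A).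
have [Q [[A -> pA] _ _]] : exists Q, [/\ S Q, unitary Q, scalmx true Q & emb O *m Q = pid_mx N].
  apply: reflections_to_pid => //.
  - by rewrite adjmx_emb -map_mxM OO map_mx1.
  - by apply/mxOverP => i j; rewrite mxE /in_mem/= /scal/= complex_real.
  - exists 1%:M; first by rewrite map_mx1.
    have -> : act (1%:M : 'M[R]_N) = id by apply/funext => v; exact: act1.
    exact: preserves_id.
  move=> _ v c [A -> pA] hv hc c0 cc.
  have [w vE] : exists w, v = emb w.
    exists (map_mx (@complex.Re R) v).
    by apply/matrixP => i j; rewrite !mxE RRe_real//; exact: (mxOverP hv i j).
  pose a := complex.Re c.
  have cE : c = a%:C%C by rewrite RRe_real.
  have a0 : a != 0 by apply: contra_neq c0; rewrite cE => ->.
  pose u : V := fun k => if insub k is Some i then w 0 i else 0.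
  have uE (i : 'I_N) : u i = w 0 i by rewrite /u valK.
  have uN k : (N <= k)%N -> u k = 0 by move=> Nk; rewrite /u insubF// ltnNge Nk.
  have uu : dot N u u = 2 * a.
    move: cc; rewrite cE conjc_real mxE => /(congr1 (@complex.Re R)).
    rewrite cre_sum /= => h; rewrite mulr_natl mulr2n h; apply: eq_bigr => k _.
    by rewrite adjmxE vE !mxE conjc_real -rmorphM/= uE.
  pose H : 'M[R]_N := 1%:M - a^-1 *: (w^T *m w).
  exists (A *m H).
    rewrite map_mxM; congr (_ *m _).
    rewrite /refl vE adjmx_emb cE -fmorphV -map_mxM -map_mxZ.
    by rewrite -(map_mx1 (real_complex R)) -map_mxB.
  have -> : act (A *m H) = act A \o act H by apply/funext => x /=; rewrite act_comp.
  apply: preserves_comp => //.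
  (* For real [c = a] the condition on [c] reads [2 a = dot N u u], and [refl] becomes a Householder
     reflection. *)
  have -> : act H = householder N u; last exact: preserves_householder.
  apply/funext => x; apply: eq_act => [i|k Nk]; last first.
    by rewrite /householder uN// mulr0 subr0.
  rewrite /householder uu uE.
  have -> : 2 * (dot N u x / (2 * a)) * w 0 i = a^-1 * (w 0 i * dot N u x).
    by field.
  rewrite /dot mulr_sumr mulr_sumr.
  under eq_bigr => j _ do rewrite mxE mulrDl.
  rewrite big_split/=; congr (_ + _).
    rewrite (bigD1 i)//= big1 ?addr0 => [|j ji]; first by rewrite mxE eqxx mul1r.
    by rewrite mxE eq_sym (negbTE ji) mul0r.
  rewrite -sumrN; apply: eq_bigr => j _; rewrite !mxE big_ord1 !mxE uE; ring.
rewrite -map_mxM => OA.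
have {}OA : O *m A = 1%:M.
  apply: emb_inj; rewrite OA map_mx1.
  by apply/matrixP => i j; rewrite !mxE ltn_ord andbT -val_eqE; case: eqP.
split; first exact: measurable_act.
move=> f mf f0; have [_ pA2] := pA.
apply: eq_trans (esym (pA2 _ (measurableT_comp mf (measurable_act O)) (fun v => f0 _))) _.
by apply: eq_integral => v _ /=; rewrite act_comp OA act1.
Qed.

End orthogonal_action.

Section samples.
Variable R : realType.
Local Notation V := (seqsp R).
Local Notation C := R[i].
Local Notation emb := (map_mx (real_complex R)).

(** Real and complex samples, both as complex matrices, so that one argument serves the two cases;
    [b] has the same meaning as in [scal]. *)
Definition mxs (b : bool) m k (v : V) : 'M[C]_(m, k) :=
  if b then emb (mx_of_seqR m k v) else mx_of_seqC m k v.

Definition nco (b : bool) m k := (if b then m * k else 2 * (m * k))%N.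

Lemma sum_ord_mul (U : nmodType) m k (F : nat -> U) :
  \sum_(p < m * k) F p = \sum_(i < m) \sum_(j < k) F (i * k + j)%N.
Proof.
elim: m => [|m IHm]; first by rewrite !big_ord0.
rewrite big_ord_recr/= -IHm -!(big_mkord xpredT F) mulSnr.
rewrite (@big_cat_nat _ _ _ (m * k)%N)//= ?leq_addr//; congr (_ + _).
by rewrite -{1}[(m * k)%N]add0n big_addn addKn big_mkord; apply: eq_bigr => j _; rewrite addnC.
Qed.

Lemma sum_ord_double (U : nmodType) n (F : nat -> U) :
  \sum_(p < 2 * n) F p = \sum_(q < n) (F (2 * q)%N + F (2 * q).+1).
Proof.
rewrite mulnC sum_ord_mul; apply: eq_bigr => q _.
by rewrite big_ord_recr big_ord1/= addn0 addn1 mulnC.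
Qed.

Lemma rtr_mxs b m k u v :
  rtr (mxs b m k u *m adjmx (mxs b m k v)) = dot (nco b m k) u v.
Proof.
rewrite /rtr /mxtrace cre_sum /dot /nco; case: b.
  rewrite (sum_ord_mul _ _ (fun p => u p * v p)); apply: eq_bigr => i _.
  rewrite mxE cre_sum; apply: eq_bigr => j _.
  by rewrite adjmxE !mxE conjc_real -rmorphM.
rewrite (sum_ord_double _ (fun p => u p * v p)).
rewrite (sum_ord_mul _ _ (fun q => u (2 * q)%N * v (2 * q)%N + u (2 * q).+1 * v (2 * q).+1)).
apply: eq_bigr => i _; rewrite mxE cre_sum; apply: eq_bigr => j _.
by rewrite adjmxE !mxE creM/= mulrN opprK.
Qed.

Lemma lt_index m k (i : 'I_m) (j : 'I_k) : (i * k + j < m * k)%N.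
Proof.
apply: (@leq_trans (i * k + k)); first by rewrite ltn_add2l.
by rewrite -mulSnr leq_mul2r ltn_ord orbT.
Qed.

Lemma eq_mxs b m k (u v : V) : (forall p, (p < nco b m k)%N -> u p = v p) ->
  mxs b m k u = mxs b m k v.
Proof.
rewrite /nco /mxs; case: b => h.
  by congr map_mx; apply/matrixP => i j; rewrite !mxE h// lt_index.
apply/matrixP => i j; rewrite !mxE; congr Complex; apply: h.
  by rewrite ltn_mul2l/= lt_index.
by rewrite !mul2n ltn_Sdouble lt_index.
Qed.

Lemma mxs_surj b m k (A : 'M[C]_(m, k)) : scalmx b A -> exists u, mxs b m k u = A.
Proof.
move=> /mxOverP hA.
pose get (g : C -> R) p := if insub (p %/ k)%N is Some i then
  if insub (p %% k)%N is Some j then g (A i j) else 0 else 0.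
have getE g (i : 'I_m) (j : 'I_k) : get g (i * k + j)%N = g (A i j).
  have k0 : (0 < k)%N by apply: leq_trans (ltn_ord j).
  by rewrite /get divnMDl// divn_small// addn0 valK modnMDl modn_small// valK.
case: b hA => hA; rewrite /mxs.
  exists (get (@complex.Re R)); apply/matrixP => i j; rewrite !mxE getE.
  by rewrite RRe_real//; exact: (hA i j).
exists (fun p => if odd p then get (@complex.Im R) p./2 else get (@complex.Re R) p./2).
apply/matrixP => i j; rewrite !mxE mul2n/= odd_double/= uphalf_double doubleK !getE.
by case: (A i j).
Qed.

Lemma mxsD b m k (u v : V) : mxs b m k (fun p => u p + v p) = mxs b m k u + mxs b m k v.
Proof. by rewrite /mxs; case: b; apply/matrixP => i j; rewrite !mxE// rmorphD. Qed.

Lemma mxsZ b m k a (u : V) : mxs b m k (fun p => a * u p) = a%:C%C *: mxs b m k u.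
Proof.
rewrite /mxs; case: b; apply/matrixP => i j; rewrite !mxE ?rmorphM//=.
by apply/eqP; rewrite eq_complex creM cimM/= !mul0r subr0 addr0 !eqxx.
Qed.

Definition basis (q : nat) : V := fun p => (p == q)%:R.

Lemma dot_basis N (u : V) (p : 'I_N) : dot N u (basis p) = u p.
Proof.
rewrite /dot (bigD1 p)//= big1 ?addr0 => [|j jp]; first by rewrite /basis eqxx mulr1.
by rewrite /basis val_eqE (negbTE jp) mulr0.
Qed.

Lemma scalmx_mxs b m k v : scalmx b (mxs b m k v).
Proof.
by apply/mxOverP => i j; rewrite /in_mem/= /scal /mxs; case: b => //=; rewrite mxE complex_real.
Qed.

Lemma mxs_sumZ b m k (I : finType) (a : I -> R) (U : I -> V) :
  mxs b m k (fun p => \sum_i a i * U i p) = \sum_i (a i)%:C%C *: mxs b m k (U i).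
Proof.
apply/matrixP => i j; rewrite summxE /mxs; case: b.
  rewrite !mxE rmorph_sum; apply: eq_bigr => l _.
  by rewrite !mxE rmorphM.
apply/eqP; rewrite mxE eq_complex cre_sum cim_sum/=.
by apply/andP; split; apply/eqP; apply: eq_bigr => l _;
  rewrite !mxE ?creM ?cimM/= mul0r ?subr0 ?addr0.
Qed.

(** Left multiplication by [Q] keeps [Re tr (A B^H)], which is the dot product of the coordinates;
    it therefore acts on the coordinates as an orthogonal matrix. *)
Lemma mxs_preserves s b m k (Q : 'M[C]_m) : s != 0 -> unitary Q -> scalmx b Q ->
  exists2 T, preserves s (nco b m k) T & forall v, mxs b m k (T v) = Q *m mxs b m k v.
Proof.
move=> s0 uQ hQ; set N := nco b m k.
have /choice[U UE] (v : V) : exists u, mxs b m k u = Q *m mxs b m k v.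
  by apply: mxs_surj; apply: scalmxM => //; exact: scalmx_mxs.
have dU u v : dot N (U u) (U v) = dot N u v.
  rewrite -!rtr_mxs !UE adjmxM mulmxA rtrC mulmxA mulmxA.
  by rewrite (proj1 (unitaryP Q) uQ) mul1mx.
(* [U] comes from a choice that is free beyond the first [N] coordinates, so the transformation is
   rebuilt from the images of the basis vectors. *)
pose O : 'M[R]_N := \matrix_(p, q) U (basis q) p.
have OO : O^T *m O = 1%:M.
  apply/matrixP => q q'; rewrite !mxE.
  transitivity (dot N (U (basis q)) (U (basis q'))).
    by apply: eq_bigr => p _; rewrite !mxE.
  by rewrite dU dot_basis /basis -val_eqE eq_sym.
exists (act O); first by apply: preserves_act => //; exact: mulmx1C.
move=> v; rewrite -UE.
have vE : mxs b m k v = \sum_(q < N) (v q)%:C%C *: mxs b m k (basis q).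
  rewrite -mxs_sumZ; apply: eq_mxs => p pN.
  rewrite -[p]/(val (Ordinal pN)) (bigD1 (Ordinal pN))//= big1 ?addr0 => [|q qp].
    by rewrite /basis eqxx mulr1.
  by rewrite /basis -val_eqE/= eq_sym in qp *; rewrite (negbTE qp) mulr0.
have -> : mxs b m k (act O v) = \sum_(q < N) (v q)%:C%C *: mxs b m k (U (basis q)).
  rewrite -mxs_sumZ; apply: eq_mxs => p pN.
  rewrite -[p]/(val (Ordinal pN)) actE; apply: eq_bigr => q _.
  by rewrite mxE mulrC.
rewrite UE vE mulmx_sumr; apply: eq_bigr => q _.
by rewrite UE scalemxAr.
Qed.

End samples.

(** * Measurability of the polar factor *)

Section measurable_matrices.
Context d (T : measurableType d) (R : realType).
Local Notation C := R[i].
Implicit Types f g : T -> C.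

Definition cmeas f := measurable_fun setT (fun t => complex.Re (f t)) /\
  measurable_fun setT (fun t => complex.Im (f t)).

Lemma cmeas_cst (z : C) : cmeas (fun=> z).
Proof. by split. Qed.

Lemma cmeasD f g : cmeas f -> cmeas g -> cmeas (fun t => f t + g t).
Proof.
move=> [f1 f2] [g1 g2]; split.
  by under eq_fun do rewrite creD; exact: measurable_funD.
by under eq_fun do rewrite cimD; exact: measurable_funD.
Qed.

Lemma cmeasM f g : cmeas f -> cmeas g -> cmeas (fun t => f t * g t).
Proof.
move=> [f1 f2] [g1 g2]; split.
  by under eq_fun do rewrite creM; apply: measurable_funB; exact: measurable_funM.
by under eq_fun do rewrite cimM; apply: measurable_funD; exact: measurable_funM.
Qed.

Lemma cmeas_real (h : T -> R) : measurable_fun setT h -> cmeas (fun t => (h t)%:C%C).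
Proof. by split. Qed.

Lemma cmeas_sum I (r : seq I) (P : pred I) (F : I -> T -> C) :
  (forall i, cmeas (F i)) -> cmeas (fun t => \sum_(i <- r | P i) F i t).
Proof.
move=> hF; elim: r => [|i r IHr].
  by under eq_fun do rewrite big_nil; exact: cmeas_cst.
by under eq_fun do rewrite big_cons; case: (P i) => //; exact: cmeasD.
Qed.

Lemma cmeas_prod I (r : seq I) (P : pred I) (F : I -> T -> C) :
  (forall i, cmeas (F i)) -> cmeas (fun t => \prod_(i <- r | P i) F i t).
Proof.
move=> hF; elim: r => [|i r IHr].
  by under eq_fun do rewrite big_nil; exact: cmeas_cst.
by under eq_fun do rewrite big_cons; case: (P i) => //; exact: cmeasM.
Qed.

Definition mxmeas m n (F : T -> 'M[C]_(m, n)) := forall i j, cmeas (fun t => F t i j).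

Lemma mxmeas_cst m n (A : 'M[C]_(m, n)) : mxmeas (fun=> A).
Proof. by move=> i j; exact: cmeas_cst. Qed.

Lemma mxmeasM m n p (F : T -> 'M[C]_(m, n)) (G : T -> 'M[C]_(n, p)) :
  mxmeas F -> mxmeas G -> mxmeas (fun t => F t *m G t).
Proof.
move=> hF hG i j; under eq_fun do rewrite mxE.
by apply: cmeas_sum => k; exact: cmeasM.
Qed.

Lemma mxmeasZ m n f (F : T -> 'M[C]_(m, n)) :
  cmeas f -> mxmeas F -> mxmeas (fun t => f t *: F t).
Proof. by move=> hf hF i j; under eq_fun do rewrite mxE; exact: cmeasM. Qed.

Lemma mxmeasD m n (F G : T -> 'M[C]_(m, n)) :
  mxmeas F -> mxmeas G -> mxmeas (fun t => F t + G t).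
Proof. by move=> hF hG i j; under eq_fun do rewrite mxE; exact: cmeasD. Qed.

Lemma mxmeasB m n (F G : T -> 'M[C]_(m, n)) :
  mxmeas F -> mxmeas G -> mxmeas (fun t => F t - G t).
Proof.
move=> hF hG; under eq_fun do rewrite -scaleN1r.
by apply: mxmeasD => //; apply: mxmeasZ => //; exact: cmeas_cst.
Qed.

Lemma mxmeas_adj m n (F : T -> 'M[C]_(m, n)) : mxmeas F -> mxmeas (fun t => adjmx (F t)).
Proof.
move=> hF i j; have [h1 h2] := hF j i; under eq_fun do rewrite adjmxE.
split.
  by move: h1; congr measurable_fun; apply/funext => t /=; case: (F t j i).
have := measurable_funN h2; congr measurable_fun.
by apply/funext => t /=; case: (F t j i).
Qed.

Lemma measurable_rtr n (F : T -> 'M[C]_n) : mxmeas F ->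
  measurable_fun setT (fun t => rtr (F t)).
Proof. by move=> hF; have [] : cmeas (fun t => \tr (F t)) by exact: cmeas_sum. Qed.

Lemma cmeas_det n (F : T -> 'M[C]_n) : mxmeas F -> cmeas (fun t => \det (F t)).
Proof.
move=> hF; apply: cmeas_sum => p; apply: cmeasM; first exact: cmeas_cst.
exact: cmeas_prod.
Qed.

Lemma measurable_unitmx n (F : T -> 'M[C]_n) : mxmeas F ->
  measurable_fun setT (fun t => F t \in unitmx).
Proof.
move=> /cmeas_det[h1 h2]; under eq_fun do rewrite unitmxE unitfE eq_complex.
by apply/measurable_neg/measurable_and; exact: measurable_fun_eqr.
Qed.

End measurable_matrices.

Section newton_schulz.
Variable R : realType.
Local Notation C := R[i].

(** The Newton-Schulz step for the polar factor, read on one singular value. It is polynomial, hence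
    measurable, and its iterates tend to the fixed point [1] from any start in [(0, 1]]. *)
Definition ns_fun (x : R) : R := 2^-1 * (x * (3 - x * x)).

(** The error satisfies [1 - ns_fun y = (1 - y) (1 - y (1 + y) / 2)]. As the iterates stay above
    [x], the second factor is at most [q = 1 - x / 2], and convergence is geometric. *)
Lemma ns_fun_cvg (x : R) : 0 < x -> x <= 1 -> (fun k => iter k ns_fun x) @ \oo --> (1 : R).
Proof.
move=> x0 x1; pose q := 1 - x / 2.
have q0 : 0 <= q by rewrite /q; lra.
have q1 : `|q| < 1 by rewrite ger0_norm// /q; lra.
have bd k : [/\ x <= iter k ns_fun x, iter k ns_fun x <= 1 & 1 - iter k ns_fun x <= q ^+ k].
  elim: k => [|k [h1 h2 h3]]; first by rewrite /= expr0; split => //; lra.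
  set y := iter k ns_fun x in h1 h2 h3 *; rewrite iterS -/y /ns_fun.
  have E : 1 - 2^-1 * (y * (3 - y * y)) = (1 - y) * (1 - y * (1 + y) / 2) by field.
  have y1 : 0 <= 1 - y by lra.
  have yy : 0 <= y * (1 - y) by rewrite mulr_ge0//; lra.
  have a0 : 0 <= 1 - y * (1 + y) / 2 by nra.
  split; first by nra.
    by rewrite -subr_ge0 E mulr_ge0.
  rewrite E exprSr; apply: ler_pM => //.
  by rewrite /q; nra.
have : (fun k => 1 - q ^+ k) @ \oo --> (1 - 0 : R).
  by apply: cvgB; [exact: cvg_cst|exact: cvg_expr].
rewrite subr0 => h.
apply: (@squeeze_cvgr _ _ _ _ (fun k => 1 - q ^+ k) (cst 1)) => //; last exact: cvg_cst.
by apply: nearW => k; have [_ -> h3] := bd k; rewrite andbT /=; lra.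
Qed.

(* The factor [exp(-|X|^2)] brings the singular values of [X] into [0, 1]. *)
Fixpoint newton_schulz d (X : 'M[C]_d) (k : nat) : 'M[C]_d :=
  if k is k'.+1 then
    let A := newton_schulz X k' in
    (2^-1)%:C%C *: (A *m (3%:R%:M - adjmx A *m A))
  else (expR (- rtr (X *m adjmx X)))%:C%C *: X.

Lemma rdiagZ d (a : R) (e : 'I_d -> R) : a%:C%C *: rdiag e = rdiag (fun i => a * e i).
Proof.
by apply/matrixP => i j; rewrite !mxE rmorphM mulrnAr.
Qed.

(** The unitary factor [Q] cancels in [A^H A], so the matrix iteration acts on each singular value
    separately. *)
Lemma newton_schulz_svd d (Q P : 'M[C]_d) (e : 'I_d -> R) (k : nat) :
  unitary Q -> unitary P ->
  newton_schulz (Q *m (adjmx P *m rdiag e *m P)) k =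
  Q *m (adjmx P *m rdiag (fun i => iter k ns_fun (expR (- \sum_i e i ^+ 2) * e i)) *m P).
Proof.
move=> hQ hP; set X := Q *m _.
have QQ : adjmx Q *m Q = 1%:M by exact/unitaryP.
have XX f : adjmx (Q *m (adjmx P *m rdiag f *m P)) *m (Q *m (adjmx P *m rdiag f *m P)) =
    adjmx P *m rdiag (fun i => f i * f i) *m P.
  rewrite !adjmxM !adjmxK adjmx_rdiag -!mulmxA (mulmxA (adjmx Q)) QQ mul1mx.
  by rewrite (mulmxA P (adjmx P)) (hP : _ = _) mul1mx (mulmxA (rdiag f)) rdiagM.
elim: k => [|k IHk] /=.
  have -> : rtr (X *m adjmx X) = \sum_i e i ^+ 2.
    rewrite rtrC XX rtrC mulmxA (hP : _ = _) mul1mx rtr_rdiag.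
    by apply: eq_bigr => i _; rewrite expr2.
  by rewrite /X scalemxAr scalemxAl scalemxAr rdiagZ.
rewrite IHk XX; set f := fun i => iter k ns_fun _.
have -> : 3%:R%:M - adjmx P *m rdiag (fun i => f i * f i) *m P =
    adjmx P *m rdiag (fun i => 3 - f i * f i) *m P.
  have -> : rdiag (fun i => 3 - f i * f i) = 3%:R%:M - rdiag (fun i => f i * f i).
    apply/matrixP => i j; rewrite !mxE -mulrnBl; congr (_ *+ _).
    by rewrite rmorphB rmorph_nat.
  by rewrite mulmxBr mulmxBl scalar_mxC -(mulmxA 3%:R%:M) (proj1 (unitaryP P) hP) mulmx1.
rewrite -!mulmxA (mulmxA P (adjmx P)) (hP : _ = _) mul1mx (mulmxA (rdiag f)) rdiagM.
by rewrite scalemxAr scalemxAr scalemxAl rdiagZ.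
Qed.

Lemma newton_schulz_cvg d (X : 'M[C]_d) i j : X \in unitmx ->
  (fun k => complex.Re (newton_schulz X k i j)) @ \oo --> complex.Re (projU X i j) /\
  (fun k => complex.Im (newton_schulz X k i j)) @ \oo --> complex.Im (projU X i j).
Proof.
move=> /svd[Q [P [e [hQ hP e0 ->]]]]; rewrite projU_svd//.
pose f k l := iter k ns_fun (expR (- \sum_i e i ^+ 2) * e l).
have fcvg l : f ^~ l @ \oo --> (1 : R).
  apply: ns_fun_cvg; first by rewrite mulr_gt0 ?expR_gt0.
  (* By [e l <= 1 + e l^2 <= 1 + S <= exp S], with [S] the sum of the squares, the rescaled singular
     value is at most [1]. *)
  rewrite expRN mulrC ler_pdivrMr ?expR_gt0// mul1r.
  apply: le_trans (expR_ge1Dx _).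
  have : e l ^+ 2 <= \sum_i e i ^+ 2.
    by rewrite (bigD1 l)//= lerDl sumr_ge0// => m _; exact: sqr_ge0.
  by move=> h; apply: le_trans (lerD (lexx 1) h); nra.
pose a l := (Q *m adjmx P) i l * P l j.
have E k : newton_schulz (Q *m (adjmx P *m rdiag e *m P)) k i j = \sum_l (f k l)%:C%C * a l.
  rewrite newton_schulz_svd// !mulmxA mxE; apply: eq_bigr => l _.
  by rewrite /a mul_mx_diag mxE [X in _ * X * _]mxE mulrAC mulrC.
have QE : Q i j = \sum_l a l.
  have -> : Q = Q *m adjmx P *m P by rewrite -mulmxA (proj1 (unitaryP P) hP) mulmx1.
  by rewrite mxE.
have cvgf (b : 'I_d -> R) : (fun k => \sum_l f k l * b l) @ \oo --> \sum_l b l.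
  rewrite [X in _ --> X](_ : _ = \sum_l 1 * b l); last by apply: eq_bigr => l _; rewrite mul1r.
  apply: cvg_big => [|l _]; first exact: add_continuous.
  by apply: cvgM => //; exact: cvg_cst.
split.
  rewrite QE cre_sum.
  apply: cvg_trans (cvgf (fun l => complex.Re (a l))); apply: near_eq_cvg.
  by apply: nearW => k; rewrite E cre_sum; apply: eq_bigr => l _; rewrite creZ.
rewrite QE cim_sum.
apply: cvg_trans (cvgf (fun l => complex.Im (a l))); apply: near_eq_cvg.
by apply: nearW => k; rewrite E cim_sum; apply: eq_bigr => l _; rewrite cimM /= mul0r addr0.
Qed.

(* A measurable version of [projU]: on singular matrices the argmin is not
   unique, so that [projU] is an arbitrary choice there. *)
Definition polar d (X : 'M[C]_d) : 'M[C]_d := if X \in unitmx then projU X else 0.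

(** A pointwise limit of measurable functions: the Newton-Schulz iterates where the matrix is
    invertible, which is a measurable condition, and [0] elsewhere. *)
Lemma mxmeas_polar d dT (T : measurableType dT) (F : T -> 'M[C]_d) :
  mxmeas F -> mxmeas (fun t => polar (F t)).
Proof.
move=> hF.
have hN k : mxmeas (fun t => newton_schulz (F t) k).
  elim: k => [|k IHk] /=.
    apply: mxmeasZ => //; apply: cmeas_real; apply: measurableT_comp => //.
    apply: measurableT_comp => //; apply: measurable_rtr; apply: mxmeasM => //.
    exact: mxmeas_adj.
  apply: mxmeasZ; first exact: cmeas_cst.
  apply: mxmeasM => //; apply: mxmeasB; first exact: mxmeas_cst.
  by apply: mxmeasM => //; exact: mxmeas_adj.
have hU := measurable_unitmx hF.
move=> i j; split.
  apply: (@measurable_fun_cvg _ _ _ setT (fun k t => if F t \in unitmx then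
      complex.Re (newton_schulz (F t) k i j) else 0)).
    by move=> k; apply: measurable_fun_ifT => //; have [] := hN k i j.
  move=> t _; rewrite /polar; case: ifPn => Ft; first by have [] := newton_schulz_cvg i j Ft.
  by rewrite mxE; exact: cvg_cst.
apply: (@measurable_fun_cvg _ _ _ setT (fun k t => if F t \in unitmx then
    complex.Im (newton_schulz (F t) k i j) else 0)).
  by move=> k; apply: measurable_fun_ifT => //; have [] := hN k i j.
move=> t _; rewrite /polar; case: ifPn => Ft; first by have [] := newton_schulz_cvg i j Ft.
by rewrite mxE; exact: cvg_cst.
Qed.

End newton_schulz.

(** * Singular matrices form a null set *)

Section singular_null.
Variables (R : realType) (s : R).
Hypothesis s0 : s != 0.
Local Notation V := (seqsp R).
Local Notation C := R[i].
Local Notation emb := (map_mx (real_complex R)).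

Lemma mxmeas_mxs b m k : mxmeas (mxs b m k : V -> 'M[C]_(m, k)).
Proof.
move=> i j; rewrite /mxs; case: b.
  have -> : (fun t : V => emb (mx_of_seqR m k t) i j) = (fun t => (t (i * k + j)%N)%:C%C).
    by apply/funext => t; rewrite !mxE.
  by apply: cmeas_real; exact: measurable_coord.
have -> : (fun t : V => mx_of_seqC m k t i j) =
    (fun t => Complex (t (2 * (i * k + j))%N) (t (2 * (i * k + j)).+1)).
  by apply/funext => t; rewrite !mxE.
by split => /=; exact: measurable_coord.
Qed.

Lemma measurable_set_seq (r : seq R) : measurable ([set` r] : set R).
Proof.
by apply: countable_measurable; [exact: measurable_set1|exact/finite_set_countable/finite_seq].
Qed.

Lemma normal_prob_finite (r : seq R) : normal_prob 0 s [set` r] = 0%E.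
Proof.
apply: null_set_integral; first exact: measurable_set_seq.
- by apply: measurable_funTS; apply/measurable_EFinP; exact: measurable_normal_pdf.
- by apply: countable_lebesgue_measure0; exact/finite_set_countable/finite_seq.
Qed.

(** If [Y + z] is singular, [z] is an eigenvalue of [-Y]; the list consists of the roots of its
    characteristic polynomial. *)
Lemma singular_shift_finite d (Y : 'M[C]_d) :
  exists r : seq C, forall z, Y + z%:M \notin unitmx -> z \in r.
Proof.
have [r rE] := closed_field_poly_normal (char_poly (- Y)).
exists r => z; rewrite unitmxE unitfE negbK => /eqP h.
have : root (char_poly (- Y)) z.
  apply/rootP; rewrite /char_poly -horner_evalE -det_map_mx -h; congr (\det _).
  apply/matrixP => i j; rewrite !mxE /= /horner_eval hornerD hornerN hornerMn hornerX.
  by rewrite hornerC opprK addrC.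
by rewrite rE (monicP (char_poly_monic _)) scale1r root_prod_XsubC.
Qed.

Lemma emb_Re m n (A : 'M[C]_(m, n)) : scalmx true A -> emb (map_mx (@complex.Re R) A) = A.
Proof.
by move=> /mxOverP hA; apply/matrixP => i j; rewrite !mxE RRe_real//; exact: (hA i j).
Qed.

(** Reflections bring the unit vector along [w] to the first basis vector; read backwards, it is the
    first column of their product. This turns the direction of [w] into a coordinate axis. *)
Lemma orthogonal_first_column N (w : V) : (0 < N)%N -> dot N w w != 0 ->
  exists2 O : 'M[R]_N, O *m O^T = 1%:M &
  forall p (i0 : 'I_N), val i0 = 0%N -> O p i0 = w p / Num.sqrt (dot N w w).
Proof.
move=> N0 w0; set r := Num.sqrt _.
have r2 : r ^+ 2 = dot N w w.
  by rewrite sqr_sqrtr// sumr_ge0// => k _; rewrite -expr2 sqr_ge0.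
have r0 : r != 0 by apply: contra_neq w0 => r0; rewrite -r2 r0 expr0n.
pose x : 'rV[R]_N := \row_p (w p / r).
have xx : emb x *m adjmx (emb x) = 1%:M.
  rewrite adjmx_emb -map_mxM -(map_mx1 (real_complex R)); congr map_mx.
  apply/matrixP => i j; rewrite !ord1 !mxE eqxx.
  transitivity (dot N w w / r ^+ 2); last by rewrite r2 divff.
  by rewrite /dot mulr_suml; apply: eq_bigr => k _; rewrite !mxE; field.
have [Q [[A QA] uQ _ xQ]] : exists Q, [/\ exists A : 'M[R]_N, Q = emb A,
    unitary Q, scalmx true Q & emb x *m Q = pid_mx 1].
  apply: reflections_to_pid => //.
  - by apply/mxOverP => i j; rewrite mxE /in_mem/= /scal/= complex_real.
  - by exists 1%:M; rewrite map_mx1.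
  move=> _ v c [A ->] hv hc c0 cc.
  exists (A *m map_mx (@complex.Re R) (refl v c)).
  by rewrite map_mxM emb_Re//; exact: scalmx_refl.
have oA : A *m A^T = 1%:M by apply/unitary_emb; rewrite -QA.
exists A => // p i0 i00.
have xE : x = pid_mx 1 *m A^T.
  have : x *m A = pid_mx 1 by apply: emb_inj; rewrite map_mxM -QA xQ map_pid_mx.
  by move=> <-; rewrite -mulmxA oA mulmx1.
have := congr1 (fun y : 'rV[R]_N => y 0 p) xE; rewrite !mxE => ->.
rewrite (bigD1 i0)//= big1 ?addr0 => [|k ki].
  by rewrite !mxE i00 mul1r.
rewrite !mxE /=; case: eqP => //= k0; last by rewrite mul0r.
by case/eqP: ki; apply: val_inj; rewrite /= -k0 i00.
Qed.

Lemma measurable_singular b m d (M : 'M[C]_(d, m)) :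
  measurable ([set v | M *m mxs b m d v \notin unitmx] : set V).
Proof.
have mG : mxmeas (fun v : V => M *m mxs b m d v).
  by apply: mxmeasM; [exact: mxmeas_cst|exact: mxmeas_mxs].
have := measurable_neg (measurable_unitmx mG) measurableT (_ : measurable [set true]).
by rewrite setTI; apply.
Qed.

(* Along the vector [w] of the entries of [M^*], the matrix [M G] is shifted by a scalar
   matrix, so that each line parallel to [w] meets [Z] in finitely many points. *)
Lemma gamma_singular b m d (M : 'M[C]_(d, m)) : (0 < d)%N ->
  M *m adjmx M = 1%:M -> scalmx b M ->
  gamma s (nco b m d) [set v | M *m mxs b m d v \notin unitmx] = 0%E.
Proof.
move=> d0 MM hM; set N := nco b m d; set Z := [set v | _].
have mZ : measurable Z by exact: measurable_singular.
(* [w] lists the coordinates of [M^H], so [M] times the matrix of [w] is the identity. *)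
have [w wE] := mxs_surj (scalmx_adj hM).
have ww : dot N w w = d%:R.
  by rewrite -rtr_mxs wE rtrC adjmxK MM rtr1.
have w0 : dot N w w != 0 by rewrite ww pnatr_eq0 -lt0n.
have N0 : (0 < N)%N.
  by case: (N) w0 => //; rewrite /dot big_ord0 eqxx.
have [U UU Ucol] := orthogonal_first_column N0 w0.
set r := Num.sqrt _ in Ucol.
have r0 : r != 0 by rewrite sqrtr_eq0 -ltNge lt_def w0 ww ler0n.
have [mT pT] := preserves_act s0 UU.
have m1 : measurable_fun setT (fun v : V => (\1_Z v)%:E : \bar R).
  by apply/measurable_EFinP; exact: measurable_indic.
have p1 v : (0 <= (\1_Z v)%:E :> \bar R)%E by rewrite lee_fin.
have -> : gamma s N Z = (\int[gamma s N]_v (\1_Z v)%:E)%E.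
  by rewrite integral_indic// setIT.
(* The law is kept by [U] and by redrawing coordinate [0]. Giving that coordinate the value [x]
   before [U] is applied adds [x / r] times [w], where [r] is the norm of [w]. *)
apply: eq_trans (esym (pT _ m1 p1)) _.
apply: eq_trans (ge0_integral_gamma_resample s N0 (measurableT_comp m1 mT) (fun v => p1 _)) _.
apply: integral0_eq => v _.
pose y := act U (upd 0 v 0).
have TE x : forall p, (p < N)%N -> act U (upd 0 v x) p = y p + x / r * w p.
  move=> p pN; rewrite -[p]/(val (Ordinal pN)) /y !actE.
  rewrite (bigD1 (Ordinal N0))//= [in RHS](bigD1 (Ordinal N0))//= Ucol// /upd eqxx mulr0 add0r.
  rewrite addrC; congr (_ + _); last by rewrite mulrC mulrA mulrAC.
  by apply: eq_bigr => i; rewrite -val_eqE /= => /negbTE ->.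
have [q qE] := singular_shift_finite (M *m mxs b m d y).
(* For a point [x] of [Z] on the line, the scalar shift [x / r] is one of the finitely many [z],
   whence [x = r Re z]. *)
pose q' := [seq complex.Re z * r | z <- q].
have sub : [set x | Z (act U (upd 0 v x))] `<=` [set` q'].
  move=> x /= Zx; apply/mapP; exists ((x / r)%:C%C); last by rewrite /= divfK.
  apply: qE; move: Zx; rewrite /Z /=.
  rewrite (@eq_mxs _ _ _ _ _ (fun p => y p + x / r * w p)); last exact: TE.
  by rewrite mxsD mxsZ wE mulmxDr -scalemxAr MM scalemx1.
apply/eqP; rewrite eq_le integral_ge0 ?andbT; last by move=> x _; exact: p1.
rewrite -(normal_prob_finite q').
have -> : normal_prob 0 s [set` q'] =
    (\int[normal_prob 0 s]_x (\1_([set` q'] : set (measurableTypeR R)) x)%:E)%E.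
  by rewrite integral_indic ?setIT//; exact: measurable_set_seq.
apply: ge0_le_integral => //.
- by move=> x _; exact: p1.
- exact: (measurableT_comp (measurableT_comp m1 mT) (measurable_upd_r 0 v)).
- by apply/measurable_EFinP; apply: measurable_indic; exact: measurable_set_seq.
move=> x _; rewrite lee_fin !indicE /=.
case: (boolP (act U (upd 0 v x) \in Z)) => [|_]; last by rewrite ler0n.
by rewrite inE => Zx; rewrite mem_set//; exact: sub.
Qed.

End singular_null.

(** * Second moments *)

Section square_integrable.
Context d (T : measurableType d) (R : realType) (P : probability T R).
Implicit Types f g : T -> R.
Local Notation Ex f := (\int[P]_t f t).

Definition integ f := P.-integrable setT (EFin \o f).

Definition sqinteg f := measurable_fun setT f /\ integ (fun t => f t ^+ 2).

Lemma integD f g : integ f -> integ g -> integ (fun t => f t + g t).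
Proof. by move=> hf hg; exact: (integrableD measurableT hf hg). Qed.

Lemma integZ a f : integ f -> integ (fun t => a * f t).
Proof. by move=> hf; exact: (integrableZl measurableT a hf). Qed.

Lemma integ_dom f g : measurable_fun setT f -> (forall t, `|f t| <= g t) ->
  integ g -> integ f.
Proof.
move=> mf fg; apply: le_integrable => //; first exact/measurable_EFinP.
by move=> t _; rewrite lee_fin (le_trans (fg t))// ler_norm.
Qed.

Lemma integ_cst a : integ (fun=> a).
Proof. exact: finite_measure_integrable_cst. Qed.

Lemma integ_sum I (r : seq I) (F : I -> T -> R) : (forall i, integ (F i)) ->
  integ (fun t => \sum_(i <- r) F i t).
Proof.
move=> hF; elim: r => [|i r IHr].
  rewrite [X in integ X](_ : _ = fun=> 0); first exact: integ_cst.
  by apply/funext => t; rewrite big_nil.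
rewrite [X in integ X](_ : _ = fun t => F i t + \sum_(j <- r) F j t); first exact: integD.
by apply/funext => t; rewrite big_cons.
Qed.

Lemma ExD f g : integ f -> integ g -> Ex (fun t => f t + g t) = Ex f + Ex g.
Proof. by move=> hf hg; rewrite RintegralD. Qed.

Lemma ExZ a f : integ f -> Ex (fun t => a * f t) = a * Ex f.
Proof. by move=> hf; rewrite RintegralZl. Qed.

Lemma Ex_sum I (r : seq I) (F : I -> T -> R) : (forall i, integ (F i)) ->
  Ex (fun t => \sum_(i <- r) F i t) = \sum_(i <- r) Ex (F i).
Proof.
move=> hF; elim: r => [|i r IHr].
  rewrite big_nil; under eq_Rintegral do rewrite big_nil.
  by rewrite Rintegral_cst// mul0r.
rewrite big_cons -IHr -ExD//; last exact: integ_sum.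
by apply: eq_Rintegral => t _; rewrite big_cons.
Qed.

Lemma Ex_ge0 f : (forall t, 0 <= f t) -> 0 <= Ex f.
Proof. by move=> f0; apply: Rintegral_ge0 => t _. Qed.

Lemma sqinteg_bounded f a : measurable_fun setT f -> (forall t, `|f t| <= a) -> sqinteg f.
Proof.
move=> mf fa; split=> //; apply: integ_dom (integ_cst (a ^+ 2)).
  exact: measurable_funX.
by move=> t; rewrite normrX lerXn2r ?nnegrE ?(le_trans _ (fa t)).
Qed.

Lemma sqinteg_prod f g : sqinteg f -> sqinteg g -> integ (fun t => f t * g t).
Proof.
move=> [mf hf] [mg hg]; apply: integ_dom (integD hf hg); first exact: measurable_funM.
by move=> t; rewrite ler_norml; nra.
Qed.

Lemma sqintegD f g : sqinteg f -> sqinteg g -> sqinteg (fun t => f t + g t).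
Proof.
move=> [mf hf] [mg hg]; split; first exact: measurable_funD.
apply: integ_dom (integD (integZ 2 hf) (integZ 2 hg)).
  by apply: measurable_funX; exact: measurable_funD.
by move=> t; rewrite ger0_norm ?sqr_ge0//; have := sqr_ge0 (f t - g t); nra.
Qed.

Lemma sqintegZ a f : sqinteg f -> sqinteg (fun t => a * f t).
Proof.
move=> [mf hf]; split; first exact: measurable_funM.
by rewrite [X in integ X](_ : _ = fun t => a ^+ 2 * f t ^+ 2);
  [exact: integZ|apply/funext => t; rewrite exprMn].
Qed.

Lemma sqinteg_cst a : sqinteg (fun=> a).
Proof. exact: (@sqinteg_bounded _ `|a|). Qed.

Lemma sqinteg_sum I (r : seq I) (F : I -> T -> R) : (forall i, sqinteg (F i)) ->
  sqinteg (fun t => \sum_(i <- r) F i t).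
Proof.
move=> hF; elim: r => [|i r IHr].
  rewrite [X in sqinteg X](_ : _ = fun=> 0); first exact: sqinteg_cst.
  by apply/funext => t; rewrite big_nil.
rewrite [X in sqinteg X](_ : _ = fun t => F i t + \sum_(j <- r) F j t); first exact: sqintegD.
by apply/funext => t; rewrite big_cons.
Qed.

Definition mxL2 m n (F : T -> 'M[R[i]]_(m, n)) := forall i j,
  sqinteg (fun t => complex.Re (F t i j)) /\ sqinteg (fun t => complex.Im (F t i j)).

Lemma mxL2_mxmeas m n (F : T -> 'M[R[i]]_(m, n)) : mxL2 F -> mxmeas F.
Proof. by move=> hF i j; have [[h1 _] [h2 _]] := hF i j; split. Qed.

Lemma mxL2_mull m n p (B : 'M[R[i]]_(m, n)) (F : T -> 'M[R[i]]_(n, p)) :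
  mxL2 F -> mxL2 (fun t => B *m F t).
Proof.
move=> hF i j; split.
  rewrite [X in sqinteg X](_ : _ = fun t => \sum_k (complex.Re (B i k) * complex.Re (F t k j) +
      - complex.Im (B i k) * complex.Im (F t k j))).
    by apply: sqinteg_sum => k; have [h1 h2] := hF k j; apply: sqintegD; exact: sqintegZ.
  by apply/funext => t; rewrite mxE cre_sum; apply: eq_bigr => k _; rewrite creM mulNr.
rewrite [X in sqinteg X](_ : _ = fun t => \sum_k (complex.Re (B i k) * complex.Im (F t k j) +
    complex.Im (B i k) * complex.Re (F t k j))).
  by apply: sqinteg_sum => k; have [h1 h2] := hF k j; apply: sqintegD; exact: sqintegZ.
by apply/funext => t; rewrite mxE cim_sum; apply: eq_bigr => k _; rewrite cimM.
Qed.

Lemma integ_rtr m n (F G : T -> 'M[R[i]]_(m, n)) : mxL2 F -> mxL2 G ->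
  integ (fun t => rtr (F t *m adjmx (G t))).
Proof.
move=> hF hG.
rewrite [X in integ X](_ : _ = fun t => \sum_i \sum_j
   (complex.Re (F t i j) * complex.Re (G t i j) + complex.Im (F t i j) * complex.Im (G t i j))).
  apply: integ_sum => i; apply: integ_sum => j.
  by have [f1 f2] := hF i j; have [g1 g2] := hG i j; apply: integD; exact: sqinteg_prod.
apply/funext => t; rewrite /rtr cre_sum; apply: eq_bigr => i _.
rewrite mxE cre_sum; apply: eq_bigr => j _; rewrite adjmxE creM.
by case: (G t i j) => x y /=; rewrite mulrN opprK.
Qed.

End square_integrable.

Section gaussian_expectation.
Variables (R : realType) (s : R).
Hypothesis s0 : s != 0.
Local Notation V := (seqsp R).
Local Notation C := R[i].

Lemma preserves_integral N (T : V -> V) (f : V -> \bar R) : preserves s N T ->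
  measurable_fun setT f -> (\int[gamma s N]_v f (T v) = \int[gamma s N]_v f v)%E.
Proof.
move=> [mT pT] mf; rewrite integralE [RHS]integralE; congr (_ - _)%E.
  apply: eq_trans (pT _ (measurable_funepos mf) (funepos_ge0 f)).
  by apply: eq_integral => v _; rewrite !funeposE.
apply: eq_trans (pT _ (measurable_funeneg mf) (funeneg_ge0 f)).
by apply: eq_integral => v _; rewrite !funenegE.
Qed.

Lemma Ex_mxs_unitary b m k (Q : 'M[C]_m) (F : 'M[C]_(m, k) -> R) :
  unitary Q -> scalmx b Q -> measurable_fun setT (fun v : V => F (mxs b m k v)) ->
  \int[gamma s (nco b m k)]_v F (Q *m mxs b m k v) =
  \int[gamma s (nco b m k)]_v F (mxs b m k v).
Proof.
move=> uQ hQ mF; have [T pT TE] := mxs_preserves k s0 uQ hQ.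
have mF' : measurable_fun setT (fun v : V => (F (mxs b m k v))%:E) by exact/measurable_EFinP.
congr fine; apply: eq_trans (preserves_integral pT mF').
by apply: eq_integral => v _; rewrite TE.
Qed.

(** Each extra coordinate is integrated against a probability measure and is not read by [f]. This
    serves to pass from a tall sample to its top square block. *)
Lemma integral_gamma_marginal N N0 (f : V -> R) : (N0 <= N)%N ->
  (forall u v : V, (forall k, (k < N0)%N -> u k = v k) -> f u = f v) ->
  measurable_fun setT f ->
  \int[gamma s N]_v f v = \int[gamma s N0]_v f v.
Proof.
move=> N0N fE mf; congr fine; elim: N N0N => [|N IHN].
  by rewrite leqn0 => /eqP ->.
rewrite leq_eqVlt => /orP[/eqP -> //|]; rewrite ltnS => N0N.
rewrite -(IHN N0N) integralE [RHS]integralE.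
have step (g : V -> \bar R) : measurable_fun setT g -> (forall v, 0 <= g v)%E ->
    (forall v x, g (upd N v x) = g v) ->
    (\int[gamma s N.+1]_v g v = \int[gamma s N]_v g v)%E.
  move=> mg g0 gE; apply: eq_trans (ge0_integral_gammaS s N mg g0) _.
  transitivity (\int[normal_prob 0 s]_x cst (\int[gamma s N]_v g v) x)%E.
    by apply: eq_integral => x _; apply: eq_integral => v _; exact: gE.
  by rewrite integral_cst// [X in (_ * X)%E](probability_setT (normal_prob 0 s)) mule1.
have fu v x : f (upd N v x) = f v.
  by apply: fE => k kN0; rewrite /upd ltn_eqF// (leq_trans kN0).
have mf' : measurable_fun setT (fun v : V => (f v)%:E) by exact/measurable_EFinP.
congr (_ - _)%E; apply: step.
- exact: measurable_funepos.
- exact: funepos_ge0.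
- by move=> v x; rewrite !funeposE fu.
- exact: measurable_funeneg.
- exact: funeneg_ge0.
- by move=> v x; rewrite !funenegE fu.
Qed.

Lemma gamma_moment2 N p : (p < N)%N ->
  (\int[gamma s N]_v ((v p) ^+ 2)%:E <= (s ^+ 2)%:E)%E.
Proof.
move=> pN.
have mp : measurable_fun setT (fun v : V => ((v p) ^+ 2)%:E).
  by apply/measurable_EFinP; apply: measurable_funX; exact: measurable_coord.
have p0 (v : V) : (0 <= ((v p) ^+ 2)%:E)%E by rewrite lee_fin sqr_ge0.
rewrite (ge0_integral_gamma_resample s pN mp p0).
have -> : (\int[gamma s N]_v \int[normal_prob 0 s]_x ((upd p v x p) ^+ 2)%:E =
    \int[gamma s N]_v cst (\int[normal_prob 0 s]_x (x ^+ 2)%:E) v)%E.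
  by apply: eq_integral => v _; apply: eq_integral => x _; rewrite /upd eqxx.
rewrite integral_cst// [X in (_ * X)%E](probability_setT (gamma s N)) mule1.
exact: normal_moment2.
Qed.

Lemma sqinteg_coord N p : (p < N)%N -> sqinteg (gamma s N) (fun v : V => v p).
Proof.
move=> pN; split; first exact: measurable_coord.
apply/integrableP; split.
  by apply/measurable_EFinP; apply: measurable_funX; exact: measurable_coord.
apply: le_lt_trans (ltry (s ^+ 2)); apply: le_trans (gamma_moment2 pN).
by rewrite le_eqVlt; apply/orP; left; apply/eqP; apply: eq_integral => v _;
  rewrite gee0_abs// lee_fin sqr_ge0.
Qed.

Lemma Ex_moment2 N p : (p < N)%N -> \int[gamma s N]_v (v p) ^+ 2 <= s ^+ 2.
Proof.
move=> pN; rewrite -lee_fin fineK; first exact: gamma_moment2.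
by have [_ h] := sqinteg_coord pN; exact: integrable_fin_num.
Qed.

Lemma mxL2_mxs b m k : mxL2 (gamma s (nco b m k)) (mxs b m k : V -> 'M[C]_(m, k)).
Proof.
move=> i j; rewrite /mxs /nco; case: b.
  split.
    rewrite [X in sqinteg _ X](_ : _ = fun v => v (i * k + j)%N); last first.
      by apply/funext => t; rewrite !mxE.
    exact/sqinteg_coord/lt_index.
  rewrite [X in sqinteg _ X](_ : _ = fun v => 0); first exact: sqinteg_cst.
  by apply/funext => t; rewrite !mxE.
split.
  rewrite [X in sqinteg _ X](_ : _ = fun v => v (2 * (i * k + j))%N); last first.
    by apply/funext => t; rewrite !mxE.
  by apply: sqinteg_coord; rewrite ltn_mul2l/= lt_index.
rewrite [X in sqinteg _ X](_ : _ = fun v => v (2 * (i * k + j)).+1); last first.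
  by apply/funext => t; rewrite !mxE.
by apply: sqinteg_coord; rewrite !mul2n ltn_Sdouble lt_index.
Qed.

Lemma Ex_mxs_sqr b m k :
  \int[gamma s (nco b m k)]_v rtr (mxs b m k v *m adjmx (mxs b m k v)) <=
  (nco b m k)%:R * s ^+ 2.
Proof.
set N := nco b m k.
have -> : \int[gamma s N]_v rtr (mxs b m k v *m adjmx (mxs b m k v)) =
    \int[gamma s N]_v \sum_(p <- index_enum 'I_N) (v p) ^+ 2.
  by apply: eq_Rintegral => v _; rewrite rtr_mxs; apply: eq_bigr => p _; rewrite expr2.
rewrite Ex_sum => [|p]; last by have [] := sqinteg_coord (ltn_ord p).
apply: le_trans (ler_sum _ (fun p _ => Ex_moment2 (ltn_ord p))) _.
by rewrite sumr_const card_ord mulr_natl.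
Qed.

End gaussian_expectation.

Section polar_factor.
Variable R : realType.
Local Notation C := R[i].

Lemma polar_unitaryl d (U X : 'M[C]_d) : unitary U -> polar (U *m X) = U *m polar X.
Proof.
move=> uU; rewrite /polar unitmx_mul (unitary_unitmx uU) /=.
by case: ifPn => hX; [exact: projU_unitaryl|rewrite mulmx0].
Qed.

Lemma polar_hermitian d (X : 'M[C]_d) : adjmx (polar X *m adjmx X) = polar X *m adjmx X.
Proof.
rewrite /polar; case: ifPn => hX; first exact: projU_hermitian.
by rewrite mul0mx adjmx0.
Qed.

Lemma polar_entry_le d (X : 'M[C]_d) i j :
  complex.Re (polar X i j) ^+ 2 + complex.Im (polar X i j) ^+ 2 <= d%:R.
Proof.
have h : rtr (polar X *m adjmx (polar X)) <= d%:R.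
  rewrite /polar; case: ifPn => hX; first by rewrite (unitary_projU hX : _ = _) rtr1.
  by rewrite mul0mx /rtr mxtrace0 ler0n.
apply: le_trans h; rewrite rtr_sqr (bigD1 i)//= (bigD1 j)//= -addrA lerDl.
by rewrite addr_ge0//; do ?(apply: sumr_ge0 => ? _); rewrite addr_ge0 ?sqr_ge0.
Qed.

Lemma mxL2_polar dT (T : measurableType dT) (P : probability T R) d (F : T -> 'M[C]_d) :
  mxmeas F -> mxL2 P (fun t => polar (F t)).
Proof.
move=> /mxmeas_polar mF i j; have [m1 m2] := mF i j.
have le1 (x y : R) : x ^+ 2 + y ^+ 2 <= d%:R -> `|x| <= 1 + d%:R.
  move=> h; have d0 : 0 <= d%:R :> R by exact: ler0n.
  by rewrite ler_norml; apply/andP; split; nra.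
split; apply: (@sqinteg_bounded _ _ _ _ _ (1 + d%:R)) => // t.
  exact: le1 (polar_entry_le (F t) i j).
by have := polar_entry_le (F t) i j; rewrite addrC; exact: le1.
Qed.

End polar_factor.

(** * Conjugation-invariant additive functionals *)

Section scalarization.
Variable R : realType.
Local Notation C := R[i].

Lemma delta_mx_mul d (i j k l : 'I_d) :
  (delta_mx i j : 'M[C]_d) *m delta_mx k l = (j == k)%:R *: delta_mx i l.
Proof.
have [->|jk] := eqVneq j k; first by rewrite mul_delta_mx scale1r.
by rewrite mul_delta_mx_0 ?scale0r.
Qed.

(* Invariance under changes of signs kills the off-diagonal entries, and
   invariance under transpositions makes the diagonal ones equal. *)
Lemma additive_conj_invariant b d (psi : 'M[C]_d -> R) :
  (forall A B, psi (A + B) = psi A + psi B) ->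
  (forall U B, unitary U -> scalmx b U -> psi (adjmx U *m B *m U) = psi B) ->
  forall B, d%:R * psi B = psi (\tr B)%:M.
Proof.
move=> psiD psiU B.
have psi0 : psi 0 = 0.
  by apply: (addrI (psi 0)); rewrite -psiD !addr0.
have psiN A : psi (- A) = - psi A.
  by apply/eqP; rewrite -addr_eq0 -psiD addNr psi0.
have psi_sum (I : finType) (F : I -> 'M[C]_d) : psi (\sum_i F i) = \sum_i psi (F i).
  exact: (big_morph psi psiD psi0).
have off i j c : i != j -> psi (c *: delta_mx i j) = 0.
  move=> ij; pose U : 'M[C]_d := 1%:M - 2 *: delta_mx i i.
  have aU : adjmx U = U.
    rewrite /U adjmxB adjmx1 adjmxZ conjc_nat; congr (_ - _ *: _).
    by apply/matrixP => k l; rewrite adjmxE !mxE conjc_nat andbC.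
  have uU : unitary U.
    rewrite /unitary aU /U mulmxBl mul1mx mulmxBr mulmx1 -!scalemxAl -scalemxAr.
    rewrite delta_mx_mul eqxx scale1r scalerA -scalerBl.
    by rewrite (_ : 2 - 2 * 2 = -2); [rewrite scaleNr opprK subrK|ring].
  have hU : scalmx b U.
    by apply/mxOverP => k l; rewrite !mxE rpredB ?rpredM ?rpred_nat.
  have h : adjmx U *m (c *: delta_mx i j) *m U = - (c *: delta_mx i j).
    have Ul : U *m delta_mx i j = - delta_mx i j.
      rewrite mulmxBl mul1mx -scalemxAl delta_mx_mul eqxx scale1r.
      by rewrite scaler_nat mulr2n opprD addrA subrr add0r.
    have Ur : delta_mx i j *m U = delta_mx i j.
      by rewrite mulmxBr mulmx1 -scalemxAr delta_mx_mul eq_sym (negbTE ij) scale0r scaler0 subr0.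
    by rewrite aU -scalemxAr -scalemxAl Ul mulNmx Ur scalerN.
  have := psiU _ (c *: delta_mx i j) uU hU; rewrite h psiN => /eqP.
  by rewrite eq_sym -addr_eq0 -mulr2n mulrn_eq0 => /eqP.
have diag i j c : psi (c *: delta_mx i i) = psi (c *: delta_mx j j).
  pose U : 'M[C]_d := tperm_mx i j.
  have aU : adjmx U = U.
    have -> : adjmx U = U^T.
      by apply/matrixP => k l; rewrite adjmxE !mxE conjc_nat.
    by rewrite tr_tperm_mx.
  have uU : unitary U by rewrite /unitary aU -perm_mxM tperm2 perm_mx1.
  have hU : scalmx b U by apply/mxOverP => k l; rewrite !mxE rpred_nat.
  rewrite -(psiU U (c *: delta_mx i i))// aU; congr psi.
  rewrite -scalemxAr -scalemxAl; congr (_ *: _).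
  have -> : U *m delta_mx i i *m U = row_perm (tperm i j) (col_perm (tperm i j) (delta_mx i i)).
    by rewrite row_permE col_permE tpermV mulmxA.
  apply/matrixP => k l; rewrite !mxE.
  by rewrite !(canF_eq (tpermK _ _)) tpermL.
have psiE A : psi A = \sum_i psi (A i i *: delta_mx i i).
  rewrite [in LHS](matrix_sum_delta A) psi_sum; apply: eq_bigr => i _.
  rewrite psi_sum (bigD1 i)//= big1 ?addr0// => j ji.
  by rewrite off// eq_sym.
have [d0|d0] := posnP d.
  by rewrite psiE [RHS]psiE !big1 ?mulr0//; move=> [i i0]; exfalso; rewrite d0 in i0.
pose o := Ordinal d0.
rewrite [RHS]psiE (eq_bigr (fun=> psi B)) => [|i _].
  by rewrite sumr_const card_ord mulr_natl.
rewrite mxE eqxx mulr1n [RHS]psiE.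
(* All diagonal entries are gathered at the position [o], where only their sum, the trace, is
   seen. *)
transitivity (psi (\sum_i B i i *: delta_mx o o)).
  by rewrite -scaler_suml; exact: diag.
by rewrite psi_sum; apply: eq_bigr => j _; exact: diag.
Qed.

End scalarization.

(** * The rounding inequality *)

Section block_psd.
Variable R : realType.
Local Notation C := R[i].

Lemma sum_mxvec_index (U : nmodType) n d (F : 'I_(n * d) -> U) :
  \sum_p F p = \sum_i \sum_a F (mxvec_index i a).
Proof.
rewrite (reindex _ (curry_mxvec_bij _ _)) pair_bigA/=.
by apply: eq_bigr => -[].
Qed.

Lemma adjmx_blk n d (A : 'M[C]_(n * d)) i j : adjmx A = A -> adjmx (blk A i j) = blk A j i.
Proof. by move=> hA; apply/matrixP => x y; rewrite adjmxE !mxE -adjmxE hA. Qed.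

(** Stacking the [X i] into one matrix [Y] turns the double sum into [Re tr (Y^H A Y)], a sum of
    values of the quadratic form at the columns of [Y]. *)
Lemma psdC_blk n d k (A : 'M[C]_(n * d)) (X : 'I_n -> 'M[C]_(d, k)) : psdC A ->
  0 <= \sum_i \sum_j rtr (adjmx (blk A i j) *m X i *m adjmx (X j)).
Proof.
move=> [hA pA].
(* The row index [p] is decoded into block and local row by the inverse of [mxvec_index]. *)
pose Y : 'M[C]_(n * d, k) := \matrix_(p, l)
  X (enum_val (cast_ord (esym (mxvec_cast n d)) p)).1
    (enum_val (cast_ord (esym (mxvec_cast n d)) p)).2 l.
have YE i x l : Y (mxvec_index i x) l = X i x l.
  by rewrite mxE /mxvec_index cast_ordK enum_rankK.
have E : adjmx Y *m A *m Y = \sum_i \sum_j adjmx (X j) *m blk A j i *m X i.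
  apply/matrixP => l l'; rewrite mxE sum_mxvec_index summxE; apply: eq_bigr => i _.
  rewrite summxE (eq_bigr (fun x => \sum_j (adjmx (X j) *m blk A j i) l x * X i x l')).
    by rewrite exchange_big; apply: eq_bigr => j _; rewrite [RHS]mxE.
  move=> x _; rewrite -mulr_suml YE; congr (_ * _).
  rewrite mxE sum_mxvec_index; apply: eq_bigr => j _; rewrite [RHS]mxE.
  by apply: eq_bigr => y _; rewrite !adjmxE YE [in RHS]mxE.
rewrite (_ : \sum_i _ = rtr (adjmx Y *m A *m Y)); last first.
  rewrite E /rtr (raddf_sum (@mxtrace _ _)) cre_sum; apply: eq_bigr => i _.
  rewrite (raddf_sum (@mxtrace _ _)) cre_sum; apply: eq_bigr => j _.
  by rewrite (adjmx_blk _ _ hA) -/(rtr _) rtrC mulmxA.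
rewrite /rtr /mxtrace cre_sum; apply: sumr_ge0 => l _.
have := pA (col l Y); rewrite lecE => /andP[_].
congr (_ <= complex.Re _).
rewrite !mxE; apply: eq_bigr => p _; rewrite !mxE; congr (_ * _).
by apply: eq_bigr => q _; rewrite !adjmxE mxE.
Qed.

End block_psd.

(** With the standard deviations of the two cases this is [alpha(d)]: for invertible [G],
    [Re tr (polar G G^H)] is the sum of the singular values, by [sum_singvalsC]. *)
Definition mean_nuclear (R : realType) (s : R) b d : R := d%:R^-1 *
  \int[gamma s (nco b d d)]_v rtr (polar (mxs b d d v) *m adjmx (mxs b d d v)).

Section rounding.
Variables (R : realType) (s : R).
Hypothesis s0 : s != 0.
Variables (b : bool) (m d : nat).
Hypothesis d0 : (0 < d)%N.
Local Notation V := (seqsp R).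
Local Notation C := R[i].
Local Notation P := (gamma s (nco b m d)).
Local Notation G := (mxs b m d).

Lemma mxL2_polar_mull (M : 'M[C]_(d, m)) : mxL2 P (fun v => polar (M *m G v)).
Proof.
apply: mxL2_polar; apply: mxmeasM; first exact: mxmeas_cst.
exact: mxmeas_mxs.
Qed.

(** Encodes the matrix [E (polar (M G) G^H)] by its real pairings with all [B], which avoids
    matrix-valued integrals. *)
Definition phi (M : 'M[C]_(d, m)) (B : 'M[C]_(m, d)) : R :=
  \int[P]_v rtr (B *m polar (M *m G v) *m adjmx (G v)).

Lemma integ_phi M B : integ P (fun v => rtr (B *m polar (M *m G v) *m adjmx (G v))).
Proof.
apply: integ_rtr; last exact: mxL2_mxs.
by apply: mxL2_mull; exact: mxL2_polar_mull.
Qed.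

Lemma phiD M A B : phi M (A + B) = phi M A + phi M B.
Proof.
rewrite /phi -ExD; try exact: integ_phi.
by apply: eq_Rintegral => v _; rewrite !mulmxDl rtrD.
Qed.

(** Substituting [Q G] for [G] leaves the law unchanged; the factor [Q^H] that comes out of the
    adjoint of [Q G] goes around the trace. *)
Lemma phi_unitary M Q B : unitary Q -> scalmx b Q -> phi (M *m Q) (adjmx Q *m B) = phi M B.
Proof.
move=> uQ hQ.
pose F g := rtr (B *m polar (M *m g) *m adjmx g).
have mF : measurable_fun setT (fun v : V => F (G v)).
  apply: measurable_rtr; apply: mxmeasM; last exact/mxmeas_adj/mxmeas_mxs.
  by apply: mxmeasM; [exact: mxmeas_cst|exact: mxL2_mxmeas (mxL2_polar_mull M)].
apply: eq_trans _ (Ex_mxs_unitary s0 uQ hQ mF).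
apply: eq_Rintegral => v _.
rewrite /F; move: (G v) => g; rewrite -(mulmxA M Q); move: (polar _) => p.
by rewrite adjmxM -!mulmxA rtrC !mulmxA.
Qed.

Lemma phi_unitaryl M U B : unitary U -> phi (U *m M) B = phi M (B *m U).
Proof.
move=> uU; apply: eq_Rintegral => v _.
move: (G v) => g; rewrite -(mulmxA U M) polar_unitaryl//; move: (polar _) => p.
by rewrite !mulmxA.
Qed.

Variable M : 'M[C]_(d, m).
Hypothesis MM : M *m adjmx M = 1%:M.
Hypothesis hM : scalmx b M.

(* The reflection [2 M^*M - 1] fixes [M G] in law and flips the part of [G] which
   is orthogonal to it. *)
Lemma phi_proj B : phi M B = phi M (adjmx M *m M *m B).
Proof.
(* The reflection [2 p - 1] is written as a sum so that the additivity of [phi] is enough to compute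
   with it. *)
pose Q : 'M[C]_m := (adjmx M *m M - 1%:M) + adjmx M *m M.
set p := adjmx M *m M in Q *.
have pp : p *m p = p by rewrite /p mulmxA -(mulmxA _ M (adjmx M)) MM mulmx1.
have ap : adjmx p = p by rewrite /p adjmxM adjmxK.
have aQ : adjmx Q = Q by rewrite /Q adjmxD adjmxB adjmx1 ap.
have uQ : unitary Q.
  have Qp : Q *m p = p by rewrite mulmxDl mulmxBl pp mul1mx subrr add0r.
  rewrite /unitary aQ {2}/Q mulmxDr mulmxBr mulmx1 Qp /Q.
  by rewrite opprD opprB addrA (addrC p) subrK addrNK.
have hp : scalmx b p by apply: scalmxM => //; exact: scalmx_adj.
have hQ : scalmx b Q.
  by apply: scalmxD => [|//]; apply: scalmxB => [//|]; exact: scalmx1.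
have MQ : M *m Q = M.
  have Mp : M *m p = M by rewrite /p mulmxA MM mul1mx.
  by rewrite /Q mulmxDr mulmxBr Mp mulmx1 subrr add0r.
have := phi_unitary M B uQ hQ; rewrite MQ aQ /Q mulmxDl mulmxBl mul1mx phiD.
move=> E.
have := phiD M (p *m B - B) B; rewrite subrK; move: E.
move: (phi M (p *m B - B)) (phi M (p *m B)) (phi M B) => x y z; lra.
Qed.

(** [Q] acts as [U] on the row space of [M] and as the identity on its orthogonal complement; a
    change of basis among the [d] rows of [M] is thus realised by a matrix acting on the sample. *)
Lemma unitary_extension (U : 'M[C]_d) (Q := 1%:M - adjmx M *m M + adjmx M *m U *m M) :
  unitary U -> unitary Q /\ M *m Q = U *m M.
Proof.
move=> uU.
pose p := adjmx M *m M.
have Mp : M *m p = M by rewrite /p mulmxA MM mul1mx.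
have pM : p *m adjmx M = adjmx M by rewrite /p -mulmxA MM mulmx1.
have ap : adjmx p = p by rewrite /p adjmxM adjmxK.
have pp : p *m p = p by rewrite {2}/p mulmxA pM.
have MQ : M *m Q = U *m M.
  by rewrite /Q -/p mulmxDr mulmxBr mulmx1 Mp subrr add0r !mulmxA MM mul1mx.
split => //.
have aQ : adjmx Q = 1%:M - p + adjmx M *m adjmx U *m M.
  by rewrite /Q -/p adjmxD adjmxB adjmx1 ap !adjmxM adjmxK !mulmxA.
rewrite /unitary aQ mulmxDr mulmxBr mulmx1.
have Qp : Q *m p = adjmx M *m U *m M.
  by rewrite /Q -/p mulmxDl mulmxBl mul1mx pp subrr add0r -(mulmxA _ M p) Mp.
have QM : Q *m adjmx M = adjmx M *m U.
  by rewrite /Q -/p mulmxDl mulmxBl mul1mx pM subrr add0r -(mulmxA _ M (adjmx M)) MM mulmx1.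
rewrite Qp !mulmxA QM -(mulmxA _ U (adjmx U)) (uU : _ = _) mulmx1 -/p /Q -/p.
by rewrite addrK subrK.
Qed.

Lemma rtr_scale_hermitian k (c : C) (S : 'M[C]_k) : adjmx S = S ->
  rtr (c *: S) = complex.Re c * rtr S.
Proof.
move=> hS; have : conjc (\tr S) = \tr S by rewrite -mxtrace_adjmx hS.
rewrite /rtr linearZ/= creM; case: (\tr S) => x y [] /eqP.
rewrite -subr_eq0 -opprD oppr_eq0 -mulr2n mulrn_eq0 => /eqP -> /=.
by rewrite mulr0 subr0.
Qed.

Definition mean_singval : R := d%:R^-1 * phi M (adjmx M).

(** With [Q] from [unitary_extension], [Q G] has the law of [G] while [M Q = U M], and the polar
    factor lets [U] through. *)
Lemma phi_conj (U B : 'M[C]_d) : unitary U -> scalmx b U ->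
  phi M (adjmx M *m (adjmx U *m B *m U)) = phi M (adjmx M *m B).
Proof.
move=> uU hU; have [] := unitary_extension uU; set Q := _ + _ => uQ MQ.
have hQ : scalmx b Q.
  have hM' := scalmx_adj hM.
  apply: scalmxD; first by apply: scalmxB; [exact: scalmx1|exact: scalmxM].
  by apply: scalmxM hM; apply: scalmxM hU.
rewrite -[RHS](phi_unitary M _ uQ hQ) [adjmx Q *m _]mulmxA -adjmxM MQ adjmxM.
by rewrite (phi_unitaryl M _ uU); congr phi; rewrite !mulmxA.
Qed.

(** By [phi_conj] the functional is conjugation invariant, so [B] may be replaced by the scalar
    [tr B / d]. The imaginary part of the trace contributes nothing, because [polar (M G)] times the
    adjoint of [M G] is Hermitian. *)
Lemma phi_adj (B : 'M[C]_d) : phi M (adjmx M *m B) = rtr B * mean_singval.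
Proof.
have h := @additive_conj_invariant _ b d (fun B => phi M (adjmx M *m B)).
have dn0 : d%:R != 0 :> R by rewrite pnatr_eq0 -lt0n.
apply: (mulfI dn0); rewrite h.
- rewrite /mean_singval mulrCA (mulVKf dn0).
  rewrite /phi -ExZ; last exact: integ_phi.
  apply: eq_Rintegral => v _.
  have S : adjmx (polar (M *m G v) *m adjmx (M *m G v)) = polar (M *m G v) *m adjmx (M *m G v).
    exact: polar_hermitian.
  have E (c : C) : rtr (adjmx M *m c%:M *m polar (M *m G v) *m adjmx (G v)) =
      rtr (c *: (polar (M *m G v) *m adjmx (M *m G v))).
    rewrite -!mulmxA rtrC -mul_scalar_mx adjmxM !mulmxA; congr rtr.
  rewrite E rtr_scale_hermitian//; congr (_ * _).
  by rewrite -[adjmx M in RHS]mulmx1 E scale1r.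
- by move=> A A'; rewrite mulmxDr phiD.
- by move=> U A uU hU; exact: phi_conj.
Qed.

(** [phi_proj] replaces [X^H] by its part [M^H M X^H] in the row space of [M], where [phi_adj]
    evaluates the expectation. *)
Lemma Ex_cross (B : 'M[C]_d) (X : 'M[C]_(d, m)) :
  \int[P]_v rtr (B *m polar (M *m G v) *m adjmx (X *m G v)) =
  rtr (B *m M *m adjmx X) * mean_singval.
Proof.
transitivity (phi M (adjmx X *m B)).
  by apply: eq_Rintegral => v _; rewrite adjmxM mulmxA rtrC !mulmxA.
rewrite phi_proj -mulmxA phi_adj; congr (_ * _).
by rewrite mulmxA rtrC mulmxA.
Qed.

Lemma pid_mxs (v : V) : (d <= m)%N -> pid_mx d *m G v = mxs b d d v.
Proof.
move=> dm; apply/matrixP => i j; rewrite mxE (bigD1 (widen_ord dm i))//= big1 ?addr0.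
  by rewrite mxE eqxx ltn_ord mul1r /mxs; case: b; rewrite !mxE.
move=> k ki; rewrite mxE; case: eqP => [ik|_]; last by rewrite mul0r.
by case/eqP: ki; apply: val_inj.
Qed.

(** Reflections bring [M] to [pid_mx d], and [M G] becomes the top [d x d] block of the sample.
    Hence the constant is the same for every [M]. *)
Lemma mean_singvalE : (d <= m)%N -> mean_singval = mean_nuclear s b d.
Proof.
move=> dm; congr (_ * _).
have [Q [_ uQ hQ MQ]] := @reflections_to_pid _ b d m M (fun=> True) dm MM hM I
  (fun _ _ _ _ _ _ _ _ => I).
rewrite -(phi_unitary M _ uQ hQ) -adjmxM MQ.
pose f (v : V) := rtr (polar (mxs b d d v) *m adjmx (mxs b d d v)).
have mf : measurable_fun setT f.
  apply: measurable_rtr; apply: mxmeasM; first exact/mxmeas_polar/mxmeas_mxs.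
  exact/mxmeas_adj/mxmeas_mxs.
rewrite -(@integral_gamma_marginal _ s (nco b m d) (nco b d d) f)//.
- apply: eq_Rintegral => v _.
  by rewrite -mulmxA rtrC -mulmxA -adjmxM pid_mxs.
- by rewrite /nco; case: b; rewrite ?leq_mul2l ?leq_mul2r ?dm ?orbT.
- by move=> u v uv; rewrite /f (@eq_mxs _ b d d u v).
Qed.

End rounding.

Section second_moment.
Variables (R : realType) (s : R).
Hypothesis s0 : s != 0.
Variables (b : bool) (m d : nat).
Local Notation V := (seqsp R).
Local Notation C := R[i].
Local Notation P := (gamma s (nco b m d)).
Local Notation G := (mxs b m d).

Lemma integ_quadratic (B : 'M[C]_m) : integ P (fun v => rtr (B *m G v *m adjmx (G v))).
Proof. by apply: integ_rtr; [apply: mxL2_mull|]; exact: mxL2_mxs. Qed.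

(** Left unitary invariance of the law makes the expectation conjugation invariant in [B], so it
    depends on the trace of [B] alone. *)
Lemma Ex_quadratic (B : 'M[C]_m) :
  m%:R * \int[P]_v rtr (B *m G v *m adjmx (G v)) =
  rtr B * \int[P]_v rtr (G v *m adjmx (G v)).
Proof.
have := @additive_conj_invariant _ b m (fun B => \int[P]_v rtr (B *m G v *m adjmx (G v))).
move=> ->.
- rewrite -ExZ; last by apply: integ_rtr; exact: mxL2_mxs.
  apply: eq_Rintegral => v _; rewrite mul_scalar_mx -scalemxAl rtr_scale_hermitian//.
  by rewrite adjmxM adjmxK.
- move=> A A'; rewrite -ExD; try exact: integ_quadratic.
  by apply: eq_Rintegral => v _; rewrite !mulmxDl rtrD.
move=> U A uU hU.
rewrite -(Ex_mxs_unitary s0 (F := fun g => rtr (A *m g *m adjmx g)) uU hU).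
  by apply: eq_Rintegral => v _; rewrite adjmxM -!mulmxA rtrC !mulmxA.
apply: measurable_rtr; apply: mxmeasM; last exact/mxmeas_adj/mxmeas_mxs.
by apply: mxmeasM; [exact: mxmeas_cst|exact: mxmeas_mxs].
Qed.

(** The equation on [s] normalises the total variance of the coordinates to [m], so that
    [E Re tr (G G^H) <= m]. *)
Lemma Ex_quadratic_le (B : 'M[C]_m) : (0 < m)%N ->
  (nco b m d)%:R * s ^+ 2 = m%:R -> 0 <= rtr B ->
  \int[P]_v rtr (B *m G v *m adjmx (G v)) <= rtr B.
Proof.
move=> m0 Ns B0; have m0' : 0 < m%:R :> R by rewrite ltr0n.
rewrite -(ler_pM2l m0') Ex_quadratic [leRHS]mulrC ler_wpM2l// -Ns.
exact: Ex_mxs_sqr.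
Qed.

End second_moment.

(** The second cross term is turned over by taking adjoints, so that in both of them the [W] factor
    stands on the left, as [Ex_cross] expects. *)
Lemma rtr_sub_scale (R : realType) k l (D : 'M[R[i]]_k) (W W' U U' : 'M[R[i]]_(k, l)) (a : R) :
  rtr (D *m (W - a%:C%C *: U) *m adjmx (W' - a%:C%C *: U')) =
  rtr (D *m W *m adjmx W') + - a * rtr (D *m W *m adjmx U') +
  - a * rtr (adjmx D *m W' *m adjmx U) + a ^+ 2 * rtr (D *m U *m adjmx U').
Proof.
have -> : rtr (adjmx D *m W' *m adjmx U) = rtr (D *m U *m adjmx W').
  by rewrite -[LHS]rtr_adjmx !adjmxM !adjmxK mulmxA rtrC mulmxA.
have -> : D *m (W - a%:C%C *: U) *m adjmx (W' - a%:C%C *: U') =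
    (D *m W *m adjmx W' - a%:C%C *: (D *m W *m adjmx U')) -
    (a%:C%C *: (D *m U *m adjmx W') - a%:C%C *: (a%:C%C *: (D *m U *m adjmx U'))).
  rewrite adjmxB adjmxZ conjc_real (mulmxBr D) (mulmxBl (D *m W)) !(mulmxBr (D *m _)).
  by rewrite -!scalemxAr -!scalemxAl.
move: (D *m W *m adjmx W') (D *m W *m adjmx U').
move: (D *m U *m adjmx W') (D *m U *m adjmx U') => p q x y.
by rewrite !rtrB !rtrZ; ring.
Qed.

Section rounding_inequality.
Variables (R : realType) (s : R).
Hypothesis s0 : s != 0.
Variables (b : bool) (n d : nat).
Hypothesis d0 : (0 < d)%N.
Hypothesis n0 : (0 < n)%N.
Local Notation V := (seqsp R).
Local Notation C := R[i].
Local Notation P := (gamma s (nco b (n * d) d)).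
Local Notation G := (mxs b (n * d) d).
Hypothesis s2 : (nco b (n * d) d)%:R * s ^+ 2 = (n * d)%:R.
Variables (A : 'M[C]_(n * d)) (X : 'I_n -> 'M[C]_(d, n * d)).
Hypothesis pA : psdC A.
Hypothesis XX : forall i, X i *m adjmx (X i) = 1%:M.
Hypothesis hX : forall i, scalmx b (X i).
Local Notation D i j := (adjmx (blk A i j)).
Local Notation W i v := (polar (X i *m G v)).
Local Notation a := (mean_nuclear s b d).

Lemma integ_rounding i j : integ P (fun v => rtr (D i j *m W i v *m adjmx (W j v))).
Proof. by apply: integ_rtr; [apply: mxL2_mull|]; exact: mxL2_polar_mull. Qed.

Lemma rounding_inequality :
  a ^+ 2 * \sum_i \sum_j rtr (D i j *m X i *m adjmx (X j)) <=
  \int[P]_v \sum_(i < n) \sum_(j < n) rtr (D i j *m W i v *m adjmx (W j v)).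
Proof.
have dnd : (d <= n * d)%N by rewrite leq_pmull.
have aE i : mean_singval s b (X i) = a by rewrite (mean_singvalE s0 (XX i) (hX i) dnd).
set T := \sum_i \sum_j rtr (D i j *m X i *m adjmx (X j)).
have T0 : 0 <= T by exact: psdC_blk.
have hG i : mxL2 P (fun v => X i *m G v) by apply: mxL2_mull; exact: mxL2_mxs.
have hW i : mxL2 P (fun v => W i v) by exact: mxL2_polar_mull.
pose w i j v := rtr (D i j *m W i v *m adjmx (W j v)).
pose x i j v := rtr (D i j *m W i v *m adjmx (X j *m G v)).
pose y i j v := rtr (adjmx (D i j) *m W j v *m adjmx (X i *m G v)).
pose q i j v := rtr (D i j *m (X i *m G v) *m adjmx (X j *m G v)).
have iw i j : integ P (w i j) by apply: integ_rtr => //; exact: mxL2_mull.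
have ix i j : integ P (x i j) by apply: integ_rtr => //; exact: mxL2_mull.
have iy i j : integ P (y i j) by apply: integ_rtr => //; exact: mxL2_mull.
have iq i j : integ P (q i j) by apply: integ_rtr => //; exact: mxL2_mull.
have Ex_x i j : \int[P]_v x i j v = rtr (D i j *m X i *m adjmx (X j)) * a.
  by rewrite -(aE i); exact: (Ex_cross s0 d0 (XX i) (hX i)).
have Ex_y i j : \int[P]_v y i j v = rtr (D i j *m X i *m adjmx (X j)) * a.
  rewrite -(aE j); apply: eq_trans (Ex_cross s0 d0 (XX j) (hX j) _ _) _.
  congr (_ * _); rewrite -[LHS]rtr_adjmx !adjmxM !adjmxK.
  by rewrite mulmxA rtrC mulmxA.
(* [B] collects the quadratic terms: the [q i j] add up to [Re tr (B G G^H)], and [Re tr B] is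
   [T]. *)
pose B := \sum_i \sum_j adjmx (X j) *m D i j *m X i.
have rB : rtr B = T.
  rewrite /B /rtr (raddf_sum (@mxtrace _ _)) cre_sum; apply: eq_bigr => i _.
  rewrite (raddf_sum (@mxtrace _ _)) cre_sum; apply: eq_bigr => j _.
  by rewrite -/(rtr _) -mulmxA rtrC.
have Ex_q : \int[P]_v (\sum_(i < n) \sum_(j < n) q i j v) <= T.
  rewrite -rB; apply: le_trans (Ex_quadratic_le s0 _ s2 _); last 2 first.
  - by rewrite muln_gt0 n0.
  - by rewrite rB.
  rewrite le_eqVlt; apply/orP; left; apply/eqP; apply: eq_Rintegral => v _.
  rewrite /B mulmx_suml mulmx_suml /rtr (raddf_sum (@mxtrace _ _)) cre_sum.
  apply: eq_bigr => i _.
  rewrite mulmx_suml mulmx_suml (raddf_sum (@mxtrace _ _)) cre_sum.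
  apply: eq_bigr => j _.
  by rewrite -/(rtr _) /q adjmxM mulmxA rtrC !mulmxA.
pose t i j v := w i j v + (- a) * x i j v + (- a) * y i j v + a ^+ 2 * q i j v.
have tE i j v : t i j v = rtr (D i j *m (W i v - a%:C%C *: (X i *m G v)) *m
    adjmx (W j v - a%:C%C *: (X j *m G v))).
  exact: esym (rtr_sub_scale _ _ _ _ _ _).
have i3 i j := integD (iw i j) (integZ (- a) (ix i j)).
have i2 i j := integD (i3 i j) (integZ (- a) (iy i j)).
have it i j : integ P (t i j) := integD (i2 i j) (integZ (a ^+ 2) (iq i j)).
(* Both cross terms have expectation [r a] and carry the factor [- a], whence [- 2 a^2 r]. *)
have Ex_t i j : \int[P]_v t i j v = \int[P]_v w i j v
    - 2 * a ^+ 2 * rtr (D i j *m X i *m adjmx (X j)) + a ^+ 2 * \int[P]_v q i j v.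
  apply: eq_trans (ExD (i2 i j) (integZ (a ^+ 2) (iq i j))) _.
  rewrite (ExZ _ (iq i j)); set e2 := a ^+ 2 * _.
  set r := rtr _.
  have -> : \int[P]_v (w i j v + - a * x i j v + - a * y i j v) =
      \int[P]_v w i j v + - a * (r * a) + - a * (r * a).
    apply: eq_trans (ExD (i3 i j) (integZ (- a) (iy i j))) _; congr (_ + _).
      apply: eq_trans (ExD (iw i j) (integZ (- a) (ix i j))) _; congr (_ + _).
      by rewrite -(Ex_x i j); exact: ExZ (ix i j).
    by rewrite -(Ex_y i j); exact: ExZ (iy i j).
  have alg (r1 r2 r3 : R) : r1 + - a * (r3 * a) + - a * (r3 * a) + r2 =
      r1 - 2 * a ^+ 2 * r3 + r2 by ring.
  exact: alg.
(* The sum of the [t i j] is the form of [A] at the blocks [W i - a X i G], nonnegative for every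
   sample. *)
have main : 0 <= \sum_i \sum_j \int[P]_v t i j v.
  rewrite (eq_bigr (fun i => \int[P]_v \sum_(j < n) t i j v)); last first.
    by move=> i _; rewrite Ex_sum.
  rewrite -Ex_sum; last by move=> i; exact: integ_sum.
  apply: Ex_ge0 => v.
  rewrite (eq_bigr (fun i => \sum_j rtr (D i j *m (W i v - a%:C%C *: (X i *m G v)) *m
    adjmx (W j v - a%:C%C *: (X j *m G v))))); first exact: psdC_blk.
  by move=> i _; apply: eq_bigr => j _; exact: tE.
have sumE (F : 'I_n -> 'I_n -> V -> R) : (forall i j, integ P (F i j)) ->
    \int[P]_v (\sum_(i < n) \sum_(j < n) F i j v) = \sum_i \sum_j \int[P]_v F i j v.
  move=> hF; rewrite Ex_sum; last by move=> i; exact: integ_sum.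
  by apply: eq_bigr => i _; rewrite Ex_sum.
rewrite (sumE _ iq) in Ex_q; rewrite (sumE _ iw).
have : \sum_i \sum_j \int[P]_v t i j v = \sum_i \sum_j \int[P]_v w i j v
    - 2 * a ^+ 2 * T + a ^+ 2 * \sum_i \sum_j \int[P]_v q i j v.
  rewrite /T !mulr_sumr -sumrB -big_split/=; apply: eq_bigr => i _.
  rewrite !mulr_sumr -sumrB -big_split/=; apply: eq_bigr => j _.
  exact: Ex_t.
have concl (w' q' t' : R) : q' <= T -> 0 <= t' ->
    t' = w' - 2 * a ^+ 2 * T + a ^+ 2 * q' -> a ^+ 2 * T <= w'.
  move=> /(ler_wpM2l (sqr_ge0 a)) h t0 E; rewrite E -mulrA in t0.
  by move: h t0; move: (a ^+ 2 * q') (a ^+ 2 * T) => x1 x2; lra.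
exact: concl Ex_q main.
Qed.

End rounding_inequality.

(** * Back to the iterated expectations of the statement *)

Section theorem2_auxiliary.
Variable R : realType.
Local Notation V := (seqsp R).
Local Notation C := R[i].
Local Notation emb := (map_mx (real_complex R)).

Lemma gauss_iter_Ex (s : R) N (f g : V -> R) (Z : set V) :
  measurable Z -> gamma s N Z = 0%E -> (forall v, ~ Z v -> f v = g v) ->
  integ (gamma s N) g -> gauss_iter s N f = (\int[gamma s N]_v g v)%:E.
Proof.
move=> mZ Z0 fg ig; rewrite fineK; last exact: integrable_fin_num.
apply: (gauss_iterE mZ Z0 fg) => //.
by apply/measurable_EFinP; have /integrableP[] := ig.
Qed.

Lemma singular_union (s : R) b m d n (M : 'I_n -> 'M[C]_(d, m)) : s != 0 -> (0 < d)%N ->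
  (forall i, M i *m adjmx (M i) = 1%:M) -> (forall i, scalmx b (M i)) ->
  exists Z : set V, [/\ measurable Z, gamma s (nco b m d) Z = 0%E &
    forall v, ~ Z v -> forall i, M i *m mxs b m d v \in unitmx].
Proof.
move=> s0 d0 MM hM.
suff [Z [mZ Z0 hZ]] : exists Z : set V, [/\ measurable Z, gamma s (nco b m d) Z = 0%E &
    forall v, ~ Z v -> forall i, i \in enum 'I_n -> M i *m mxs b m d v \in unitmx].
  by exists Z; split => // v Zv i; apply: hZ => //; rewrite mem_enum.
elim: (enum 'I_n) => [|i r [Z [mZ Z0 hZ]]].
  by exists set0; split => //; exact: measure0.
exists ([set v | M i *m mxs b m d v \notin unitmx] `|` Z); split.
- by apply: measurableU => //; exact: measurable_singular.
- apply: null_set_setU => //; first exact: measurable_singular.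
  exact: (gamma_singular s0 d0 (MM i) (hM i)).
- move=> v /not_orP[/negP]; rewrite negbK => h Zv j.
  by rewrite inE => /orP[/eqP -> //|]; exact: hZ.
Qed.

(** Symmetry makes the value of the form real; for [v = x + i y] it equals [x^T A x + y^T A y]. *)
Lemma psdC_emb N (A : 'M[R]_N) : psdR A -> psdC (emb A).
Proof.
move=> [hA pA]; have aA : adjmx (emb A) = emb A by rewrite adjmx_emb hA.
split => // v; set z := _ 0 0.
have zr : conjc z = z.
  by rewrite /z -adjmxE !adjmxM adjmxK aA mulmxA.
have Im0 : complex.Im z = 0.
  move: zr; case: (z) => x y [] /eqP; rewrite -subr_eq0 -opprD oppr_eq0.
  by rewrite -mulr2n mulrn_eq0 => /eqP.
rewrite lecE Im0 eqxx/=.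
pose x := map_mx (@complex.Re R) v; pose y := map_mx (@complex.Im R) v.
suff -> : complex.Re z = (x^T *m A *m x) 0 0 + (y^T *m A *m y) 0 0 by exact: addr_ge0.
rewrite /z !mxE cre_sum -big_split/=; apply: eq_bigr => p _.
have -> : (adjmx v *m emb A) 0 p = Complex ((x^T *m A) 0 p) (- (y^T *m A) 0 p).
  apply/eqP; rewrite eq_complex !mxE cre_sum cim_sum -sumrN/=.
  apply/andP; split; apply/eqP; apply: eq_bigr => q _; rewrite adjmxE !mxE.
    by rewrite creM/= mulr0 subr0; case: (v q 0).
  by rewrite cimM/= mulr0 add0r; case: (v q 0) => u w /=; rewrite mulNr.
by rewrite creM/= mulNr opprK !mxE.
Qed.

End theorem2_auxiliary.

Section mean_singular_value.
Variables (R : realType) (d : nat).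
Hypothesis d0 : (0 < d)%N.
Local Notation emb := (map_mx (real_complex R)).

(** Singular samples are null by the case [M = 1] of [gamma_singular]; on the others the sum of
    singular values is the measurable function [rtr (polar G *m adjmx G)]. *)
Lemma gauss_iter_singvals (b : bool) (s : R) (f : seqsp R -> R) : s != 0 ->
  (forall v, mxs b d d v \in unitmx -> f v = \sum_(x <- singvalsC (mxs b d d v)) x) ->
  gauss_iter s (nco b d d) (fun v => d%:R^-1 * f v) = (mean_nuclear s b d)%:E.
Proof.
move=> s0 fE.
have ig : integ (gamma s (nco b d d))
    (fun v => rtr (polar (mxs b d d v) *m adjmx (mxs b d d v))).
  apply: integ_rtr; last exact: mxL2_mxs.
  by apply: mxL2_polar; exact: mxmeas_mxs.
have I1 : (1%:M : 'M[R[i]]_d) *m adjmx 1%:M = 1%:M by rewrite adjmx1 mulmx1.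
have mZ := measurable_singular b (1%:M : 'M[R[i]]_d).
have Z0 := gamma_singular s0 d0 I1 (@scalmx1 R b d).
pose g (v : seqsp R) := d%:R^-1 * rtr (polar (mxs b d d v) *m adjmx (mxs b d d v)).
rewrite (@gauss_iter_Ex _ s (nco b d d) _ g _ mZ Z0 _ (integZ d%:R^-1 ig)).
  by rewrite (ExZ _ ig).
move=> v /negP; rewrite negbK mul1mx => hv; congr (_ * _).
by rewrite fE// sum_singvalsC// /polar hv.
Qed.

Lemma alphaC_mean : alphaC R d = (mean_nuclear (Num.sqrt ((2 * d)%:R^-1)) false d)%:E.
Proof.
apply: (@gauss_iter_singvals false) => //.
by rewrite sqrtr_eq0 -ltNge invr_gt0 ltr0n muln_gt0.
Qed.

Lemma alphaR_mean : alphaR R d = (mean_nuclear (Num.sqrt (d%:R^-1)) true d)%:E.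
Proof.
apply: (@gauss_iter_singvals true) => [|v _].
  by rewrite sqrtr_eq0 -ltNge invr_gt0 ltr0n.
by rewrite singvalsR_emb.
Qed.

End mean_singular_value.

Local Notation emb := (map_mx (real_complex _)).

Lemma adjmx_blk_emb (R : realType) n d (A : 'M[R]_(n * d)) i j :
  adjmx (blk (map_mx (real_complex R) A) i j) = map_mx (real_complex R) (blk A i j)^T.
Proof. by apply/matrixP => x y; rewrite !mxE conjc_real. Qed.

Theorem theorem2 (R : realType) (d n : nat) (hd : (0 < d)%N) (hn : (0 < n)%N) :
  (forall (C : 'M[R]_(n * d)) (X : 'I_n -> 'M[R]_(d, n * d)),
     psdR C ->
     (forall i, X i *m (X i)^T = 1%:M) ->
     (EgaussR d (fun G : 'M[R]_(n * d, d) =>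
        (\sum_(i < n) \sum_(j < n)
          \tr ((blk C i j)^T *m projO (X i *m G) *m (projO (X j *m G))^T))%R)
      >= alphaR R d * alphaR R d *
         (\sum_(i < n) \sum_(j < n) \tr ((blk C i j)^T *m X i *m (X j)^T))%R%:E)%E)
  /\
  (forall (C : 'M[R[i]]_(n * d)) (Y : 'I_n -> 'M[R[i]]_(d, n * d)),
     psdC C ->
     (forall i, Y i *m adjmx (Y i) = 1%:M) ->
     (EgaussC d (fun G : 'M[R[i]]_(n * d, d) =>
        complex.Re (\sum_(i < n) \sum_(j < n)
          \tr (adjmx (blk C i j) *m projU (Y i *m G) *m adjmx (projU (Y j *m G))))%R)
      >= alphaC R d * alphaC R d *
         (complex.Re (\sum_(i < n) \sum_(j < n)
            \tr (adjmx (blk C i j) *m Y i *m adjmx (Y j)))%R)%:E)%E).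
Proof.
have dR0 : d%:R != 0 :> R by rewrite pnatr_eq0 -lt0n.
split=> [C X pC XX|C Y pC YY].
  pose s : R := Num.sqrt (d%:R^-1).
  have s0 : s != 0 by rewrite sqrtr_eq0 -ltNge invr_gt0 ltr0n.
  (* The sample has [n d d] real coordinates of variance [1 / d]. *)
  have s2 : (nco true (n * d) d)%:R * s ^+ 2 = (n * d)%:R.
    by rewrite sqr_sqrtr ?invr_ge0// /nco (natrM _ (n * d) d) mulfK.
  have XX' i : emb (X i) *m adjmx (emb (X i)) = 1%:M.
    by rewrite adjmx_emb -map_mxM XX map_mx1.
  have hX i : scalmx true (emb (X i)).
    by apply/mxOverP => k l; rewrite mxE /in_mem/= /scal/= complex_real.
  have [Z [mZ Z0 hZ]] := singular_union s0 hd XX' hX.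
  have ineq := rounding_inequality s0 hd hn s2 (psdC_emb pC) XX' hX.
  (* The measurable integrand: [polar] stands for the projection and agrees with it off the null set
     [Z]. *)
  pose g v := \sum_(i < n) \sum_(j < n) rtr (adjmx (blk (emb C) i j) *m
    polar (emb (X i) *m mxs true (n * d) d v) *m
    adjmx (polar (emb (X j) *m mxs true (n * d) d v))).
  have ig : integ (gamma s (nco true (n * d) d)) g.
    apply: integ_sum => i; apply: integ_sum => j.
    exact: (integ_rounding s true (emb C) (fun i => emb (X i)) i j).
  have rtrE (F H : 'I_n -> 'M[R]_(d, n * d)) (D : 'M[R]_d) k (A B : 'M[R]_(d, k)) :
      \tr (D *m A *m B^T) = rtr (emb D *m emb A *m adjmx (emb B)).
    by rewrite adjmx_emb -!map_mxM rtr_emb.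
  rewrite alphaR_mean// /EgaussR.
  rewrite (@gauss_iter_Ex _ s (nco true (n * d) d) _ g Z mZ Z0 _ ig).
    rewrite -!EFinM lee_fin -expr2; apply: le_trans ineq.
    rewrite le_eqVlt; apply/orP; left; apply/eqP; congr (_ * _).
    apply: eq_bigr => i _; apply: eq_bigr => j _.
    by rewrite adjmx_blk_emb rtrE.
  move=> v Zv; apply: eq_bigr => i _; apply: eq_bigr => j _.
  (* Off [Z] every [X k *m G] is invertible, and there the real and the complex projections
     agree. *)
  have polE k : polar (emb (X k) *m mxs true (n * d) d v) =
      emb (projO (X k *m mx_of_seqR (n * d) d v)).
    have XG : emb (X k) *m mxs true (n * d) d v = emb (X k *m mx_of_seqR (n * d) d v).
      by rewrite map_mxM.
    have := hZ v Zv k; rewrite /polar XG => h; rewrite h emb_projO//.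
    by rewrite map_unitmx in h.
  by rewrite !polE adjmx_blk_emb rtrE.
pose s : R := Num.sqrt ((2 * d)%:R^-1).
have s0 : s != 0 by rewrite sqrtr_eq0 -ltNge invr_gt0 ltr0n muln_gt0.
(* Real and imaginary parts give [2 n d d] coordinates of variance [1 / (2 d)], with the same total
   [n d]. *)
have s2 : (nco false (n * d) d)%:R * s ^+ 2 = (n * d)%:R.
  rewrite sqr_sqrtr ?invr_ge0// /nco mulnCA (natrM _ (n * d)) mulfK//.
  by rewrite pnatr_eq0 muln_eq0 -lt0n.
have hY i : scalmx false (Y i) by apply/mxOverP.
have [Z [mZ Z0 hZ]] := singular_union s0 hd YY hY.
have ineq := rounding_inequality s0 hd hn s2 pC YY hY.
pose g v := \sum_(i < n) \sum_(j < n) rtr (adjmx (blk C i j) *m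
  polar (Y i *m mxs false (n * d) d v) *m adjmx (polar (Y j *m mxs false (n * d) d v))).
have ig : integ (gamma s (nco false (n * d) d)) g.
  by apply: integ_sum => i; apply: integ_sum => j; exact: (integ_rounding s false C Y i j).
have sumE (k : nat) (F : 'I_n -> 'I_n -> 'M[R[i]]_k) :
    complex.Re (\sum_i \sum_j \tr (F i j)) = \sum_i \sum_j rtr (F i j).
  by rewrite cre_sum; apply: eq_bigr => i _; rewrite cre_sum.
rewrite alphaC_mean// /EgaussC.
rewrite (@gauss_iter_Ex _ s (nco false (n * d) d) _ g Z mZ Z0 _ ig).
  by rewrite -!EFinM lee_fin -expr2 sumE.
move=> v Zv; rewrite sumE; apply: eq_bigr => i _; apply: eq_bigr => j _.
by rewrite /polar !(hZ v Zv).
Qed.
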